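(* For every bipointed computad $C$ (i.e. every object of $\mathrm{Comp}^{\star\star}$), the hom $\omega$-category $\Omega K^{T^{\star\star}}C$ is free on a computad; that is, there exists a computad $D$ and an isomorphism of $\omega$-categories $K^{T}D\cong \Omega K^{T^{\star\star}}C$.
   Context: **Globular sets.** The category $\mathbb G$ of globes has objects $[n]$, $n\in\mathbb N$, and morphisms freely generated by $s_n,t_n:[n]\to[n+1]$ subject to $s_{n+1}s_n=t_{n+1}s_n$ and $s_{n+1}t_n=t_{n+1}t_n$. A globular set $X$ is a presheaf on $\mathbb G$: sets $X_n$ of $n$-cells and functions $\mathrm{src},\mathrm{tgt}:X_{n+1}\to X_n$ with $\mathrm{src}\,\mathrm{src}=\mathrm{src}\,\mathrm{tgt}$, $\mathrm{tgt}\,\mathrm{src}=\mathrm{tgt}\,\mathrm{tgt}$. Globular sets form the category $\mathrm{Glob}$. For an $n$-cell $x$ and $k<n$, $\mathrm{src}_kx$, $\mathrm{tgt}_kx$ are the iterated source and target in dimension $k$. $\mathbb D^n$ is the globular set represented by $[n]$. A bipointed globular set $(X,x_-,x_+)$ is a globular set with two distinguished $0$-cells; with basepoint-preserving morphisms these form $\mathrm{Glob}^{\star\star}$. The wedge $X\vee Y$ of bipointed globular sets is the pushout of $X\xleftarrow{x_+}\mathbb D^0\xrightarrow{y_-}Y$ with basepoints the images of $x_-$ and $y_+$; $\bigvee_{i=1}^nX_i$ is the iterated wedge (the empty wedge is $\mathbb D^0$ with both basepoints its unique $0$-cell). The suspension $\Sigma X$ of a globular set has $(\Sigma X)_0=\{v_-,v_+\}$,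 $(\Sigma X)_{n+1}=X_n$, source and target of cells of dimension $\ge2$ as in $X$, and every $1$-cell has source $v_-$ and target $v_+$; basepoints are $v_-,v_+$. It is left adjoint to $\Omega:\mathrm{Glob}^{\star\star}\to\mathrm{Glob}$, $\Omega(X,x_-,x_+)_n=\{x\in X_{n+1}: \mathrm{src}_0x=x_-,\ \mathrm{tgt}_0x=x_+\}$, with identity unit ($\Omega\Sigma=\mathrm{id}$) and counit $\kappa:\Sigma\Omega\Rightarrow\mathrm{id}$ given by the inclusions. **Batanin trees.** A Batanin tree is (inductively) a finite list $\mathrm{br}[B_1,\dots,B_n]$ of Batanin trees, $n\ge0$. Its dimension is $\dim\mathrm{br}[\,]=0$, $\dim\mathrm{br}[B_1,\dots,B_n]=\max_i(\dim B_i+1)$. Its bipointed globular set of positions is $\mathrm{Pos}(\mathrm{br}[B_1,\dots,B_n])=\bigvee_{i=1}^n\Sigma\mathrm{Pos}(B_i)$. The $k$-boundary is $\partial_0B=\mathrm{br}[\,]$, $\partial_{k+1}\mathrm{br}[B_1,\dots,B_n]=\mathrm{br}[\partial_kB_1,\dots,\partial_kB_n]$. The source and target inclusions $s_k^B,t_k^B:\mathrm{Pos}(\partial_kB)\to\mathrm{Pos}(B)$ are: $s_0^B,t_0^B$ pick the first and second basepoint; $s_{k+1}^B=\bigvee_i\Sigma s_k^{B_i}$, $t_{k+1}^B=\bigvee_i\Sigma t_k^{B_i}$ for $B=\mathrm{br}[B_1,\dots,B_n]$. **Computads.** By mutual recursion on $n$ one defines categories $\mathrm{Comp}_n$ of $n$-computads,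 forgetful functors $u_n:\mathrm{Comp}_n\to\mathrm{Comp}_{n-1}$, functors $\mathrm{Free}_n:\mathrm{Glob}\to\mathrm{Comp}_n$, $\mathrm{Cell}_n,\mathrm{Sph}_n:\mathrm{Comp}_n\to\mathrm{Set}$ and natural transformations $\mathrm{bdry}_n:\mathrm{Cell}_n\Rightarrow\mathrm{Sph}_{n-1}u_n$ and $\mathrm{pr}_1,\mathrm{pr}_2:\mathrm{Sph}_n\Rightarrow\mathrm{Cell}_n$. Base: $\mathrm{Comp}_{-1}$ is terminal and $\mathrm{Sph}_{-1}$ picks a one-element set. An $n$-computad is $C=(C_{n-1},V_n^C,\phi_n^C)$ with $C_{n-1}$ an $(n-1)$-computad, $V_n^C$ a set (generators), $\phi_n^C:V_n^C\to\mathrm{Sph}_{n-1}(C_{n-1})$. A morphism $\sigma:C\to D$ is a pair $(\sigma_{n-1}:C_{n-1}\to D_{n-1},\ \sigma_V=\sigma_{n,V}:V_n^C\to\mathrm{Cell}_nD)$ with $\mathrm{bdry}_{n,D}\circ\sigma_V=\mathrm{Sph}_{n-1}(\sigma_{n-1})\circ\phi_n^C$; composition is $\sigma\circ\tau=(\sigma_{n-1}\tau_{n-1},\mathrm{Cell}_n(\sigma)\circ\tau_V)$, identities are $(\mathrm{id},\mathrm{var})$, and $u_n$ is projection. The set $\mathrm{Cell}_nC$ is inductively generated by: $\mathrm{var}\,v$ for $v\in V_n^C$; and, if $n>0$, coherence cells $\mathrm{coh}(B,A,\tau)$, where $B$ is a Batanin tree with $\dim B\le n$, $A\in\mathrm{Sph}_{n-1}(\mathrm{Free}_{n-1}\mathrm{Pos}(B))$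 is full (see below) and $\tau:\mathrm{Free}_n\mathrm{Pos}(B)\to C$ is a morphism. Boundaries: $\mathrm{bdry}(\mathrm{var}\,v)=\phi_n^C(v)$, $\mathrm{bdry}(\mathrm{coh}(B,A,\tau))=\mathrm{Sph}_{n-1}(\tau_{n-1})(A)$. Action of $\sigma:C\to D$: $\mathrm{var}\,v\mapsto\sigma_V(v)$, $\mathrm{coh}(B,A,\tau)\mapsto\mathrm{coh}(B,A,\sigma\circ\tau)$. $\mathrm{Sph}_nC=\{(a,b)\in(\mathrm{Cell}_nC)^2:\mathrm{bdry}_na=\mathrm{bdry}_nb\}$ with projections $\mathrm{pr}_1,\mathrm{pr}_2$. $\mathrm{Free}_nX=(\mathrm{Free}_{n-1}X,X_n,x\mapsto(\mathrm{var}(\mathrm{src}\,x),\mathrm{var}(\mathrm{tgt}\,x)))$, acting on $f$ by $(\mathrm{Free}_{n-1}f,\mathrm{var}\circ f_n)$. Support of a cell: $\mathrm{supp}(\mathrm{var}\,v)=\{v\}$ if $n=0$ and $\{v\}\cup\mathrm{supp}(\mathrm{pr}_1\phi_n^C(v))\cup\mathrm{supp}(\mathrm{pr}_2\phi_n^C(v))$ if $n>0$; $\mathrm{supp}(\mathrm{coh}(B,A,\tau))=\bigcup_{k\le n}\bigcup_{p\in\mathrm{Pos}(B)_k}\mathrm{supp}(\tau_{k,V}(p))$. A sphere $(a,b)\in\mathrm{Sph}_n(\mathrm{Free}_n\mathrm{Pos}(B))$ is full if $a=\mathrm{Cell}_n\mathrm{Free}_n(s_n^B)(a')$ and $b=\mathrm{Cell}_n\mathrm{Free}_n(t_n^B)(b')$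 for $n$-cells $a',b'$ of $\mathrm{Free}_n\mathrm{Pos}(\partial_nB)$ whose supports contain all positions of $\partial_nB$. $\mathrm{Comp}$ is the limit of the $\mathrm{Comp}_n$: a computad is a sequence $C=(C_n)_n$ with $u_{n+1}C_{n+1}=C_n$. $\mathrm{Free}:\mathrm{Glob}\to\mathrm{Comp}$ has components $\mathrm{Free}_n$; $\mathrm{Cell}:\mathrm{Comp}\to\mathrm{Glob}$ sends $C$ to the globular set with $n$-cells $\mathrm{Cell}_nC_n$, and source and target the projections of $\mathrm{bdry}$. $\mathrm{Free}\dashv\mathrm{Cell}$ with unit $\eta(x)=\mathrm{var}\,x$ and counit $\varepsilon_C:\mathrm{Free}\,\mathrm{Cell}\,C\to C$ given on generators by the identities $V_n^{\mathrm{Free}\,\mathrm{Cell}\,C}=\mathrm{Cell}_nC$. Let $T=\mathrm{Cell}\,\mathrm{Free}$ with its induced monad structure $(T,\mu,\eta)$. An (weak) $\omega$-category is a $T$-algebra; they form $\omega\mathrm{Cat}$. The comparison functor $K^T:\mathrm{Comp}\to\omega\mathrm{Cat}$ is $C\mapsto(\mathrm{Cell}\,C,\mathrm{Cell}\,\varepsilon_C)$; an $\omega$-category is free on a computad if it is isomorphic to some $K^TC$. **Bipointed versions.** $\mathrm{Comp}^{\star\star}$ is the category of computads with two chosen $0$-cells and morphisms preserving them; $\omega\mathrm{Cat}^{\star\star}$ is the category of $\omega$-categories with two chosen $0$-cells and morphisms preserving them. The adjunction lifts to $\mathrm{Free}^{\star\star}:\mathrm{Glob}^{\star\star}\rightleftarrows\mathrm{Comp}^{\star\star}:\mathrm{Cell}^{\star\star}$,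 with $\mathrm{Free}^{\star\star}(X,x_\pm)=(\mathrm{Free}X,\mathrm{var}\,x_\pm)$, $\mathrm{Cell}^{\star\star}(C,c_\pm)=(\mathrm{Cell}\,C,c_\pm)$; the induced monad is $T^{\star\star}(X,x_\pm)=(TX,\mathrm{var}\,x_\pm)$, whose algebras are the bipointed $\omega$-categories; $K^{T^{\star\star}}:\mathrm{Comp}^{\star\star}\to\omega\mathrm{Cat}^{\star\star}$ is the comparison functor. **Suspension of computads.** Put $\Sigma B=\mathrm{br}[B]$, so $\mathrm{Pos}(\Sigma B)=\Sigma\mathrm{Pos}(B)$. Functors $\Sigma:\mathrm{Comp}_n\to\mathrm{Comp}_{n+1}$ and natural transformations $\Sigma^{\mathrm{Cell}}:\mathrm{Cell}_n\Rightarrow\mathrm{Cell}_{n+1}\Sigma$, $\Sigma^{\mathrm{Sph}}:\mathrm{Sph}_n\Rightarrow\mathrm{Sph}_{n+1}\Sigma$ are defined recursively: for $n=-1$, $\Sigma$ picks the set $\{v_-,v_+\}\in\mathrm{Comp}_0=\mathrm{Set}$ and $\Sigma^{\mathrm{Sph}}$ picks $(\mathrm{var}\,v_-,\mathrm{var}\,v_+)$; for $n\ge0$, $\Sigma C=(\Sigma C_{n-1},V_n^C,\Sigma^{\mathrm{Sph}}\circ\phi_n^C)$, $\Sigma\sigma=(\Sigma\sigma_{n-1},\Sigma^{\mathrm{Cell}}\circ\sigma_V)$, $\Sigma^{\mathrm{Cell}}(\mathrm{var}\,v)=\mathrm{var}\,v$, $\Sigma^{\mathrm{Cell}}(\mathrm{coh}(B,A,\tau))=\mathrm{coh}(\Sigma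 B,\Sigma^{\mathrm{Sph}}A,\Sigma\tau)$, $\Sigma^{\mathrm{Sph}}(a,b)=(\Sigma^{\mathrm{Cell}}a,\Sigma^{\mathrm{Cell}}b)$. (These are well defined and $\Sigma\,\mathrm{Free}_n=\mathrm{Free}_{n+1}\Sigma$.) They assemble to $\Sigma:\mathrm{Comp}\to\mathrm{Comp}^{\star\star}$ with $(\Sigma C)_0=\{v_-,v_+\}$, $(\Sigma C)_{n+1}=\Sigma C_n$, basepoints $\mathrm{var}\,v_\pm$, satisfying $\Sigma\,\mathrm{Free}=\mathrm{Free}^{\star\star}\Sigma$, and to $\Sigma^{\mathrm{Cell}}:\Sigma\,\mathrm{Cell}\Rightarrow\mathrm{Cell}^{\star\star}\Sigma$ (sending $v_\pm$ to $\mathrm{var}\,v_\pm$). **Hom $\omega$-categories.** Let $\Sigma^T=\Sigma^{\mathrm{Cell}}\mathrm{Free}:\Sigma T\Rightarrow T^{\star\star}\Sigma$ and let $\Omega^T=(\Omega T^{\star\star}\kappa)\circ(\Omega\Sigma^T\Omega):T\Omega\Rightarrow\Omega T^{\star\star}$. The hom $\omega$-category of a bipointed $\omega$-category $(X,\alpha:TX\to X,x_-,x_+)$ is $\Omega(X,x_-,x_+)$ with structure map $T\Omega X\xrightarrow{\Omega^T}\Omega T^{\star\star}X\xrightarrow{\Omega\alpha}\Omega X$. This defines a functor $\Omega:\omega\mathrm{Cat}^{\star\star}\to\omega\mathrm{Cat}$. *)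

(* Defs.v *)
From mathcomp Require Import ssreflect ssrfun ssrbool eqtype ssrnat seq boolp.

Set Implicit Arguments.
Unset Strict Implicit.
Unset Printing Implicit Defensive.

#[local] Obligation Tactic := intros.

Record glob := Glob {
  gcell :> nat -> Type;
  src : forall n, gcell n.+1 -> gcell n;
  tgt : forall n, gcell n.+1 -> gcell n;
  src_glob : forall n (x : gcell n.+2), src (src x) = src (tgt x);
  tgt_glob : forall n (x : gcell n.+2), tgt (src x) = tgt (tgt x) }.

Arguments src {g n} x.
Arguments tgt {g n} x.

Record gmap (X Y : glob) := GMap {
  gfun :> forall n, X n -> Y n;
  gfun_src : forall n (x : X n.+1), gfun (src x) = src (gfun x);
  gfun_tgt : forall n (x : X n.+1), gfun (tgt x) = tgt (gfun x) }.

Arguments gfun {X Y} _ {n} _.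

Lemma gmap_eq (X Y : glob) (f g : gmap X Y) :
  (forall n (x : X n), f n x = g n x) -> f = g.
Proof.
case: f g => [f fs ft] [g gs gt] /= fg.
have {}fg : f = g.
  by apply: functional_extensionality_dep => n; apply: funext => x; exact: fg.
by subst g; rewrite (Prop_irrelevance fs gs) (Prop_irrelevance ft gt).
Qed.

Definition gid (X : glob) : gmap X X :=
  @GMap X X (fun n x => x) (fun n x => erefl) (fun n x => erefl).

Program Definition gcomp (X Y Z : glob) (g : gmap Y Z) (f : gmap X Y) :
  gmap X Z := @GMap X Z (fun n x => g n (f n x)) _ _.
Next Obligation. by rewrite /= !gfun_src. Qed.
Next Obligation. by rewrite /= !gfun_tgt. Qed.

Fixpoint src0 (X : glob) n : X n -> X 0 :=
  match n with 0 => fun x => x | k.+1 => fun x => src0 (src x) end.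
Fixpoint tgt0 (X : glob) n : X n -> X 0 :=
  match n with 0 => fun x => x | k.+1 => fun x => tgt0 (tgt x) end.

Inductive pole := vminus | vplus.

Record bglob := BGlob { bcar :> glob; bpt : pole -> bcar 0 }.

Record bgmap (X Y : bglob) := BGMap {
  bgfun :> gmap X Y;
  bgfun_pt : forall e, bgfun 0 (bpt X e) = bpt Y e }.

Definition bgid (X : bglob) : bgmap X X := @BGMap X X (gid X) (fun e => erefl).

Program Definition bgcomp (X Y Z : bglob) (g : bgmap Y Z) (f : bgmap X Y) :
  bgmap X Z := @BGMap X Z (gcomp g f) _.
Next Obligation. by rewrite /= !bgfun_pt. Qed.

Definition D0_cell (n : nat) : Type := if n is 0 then unit else void.

Program Definition D0 : glob :=
  @Glob D0_cell (fun n x => match x : void with end)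
    (fun n x => match x : void with end) _ _.
Next Obligation. by case: x. Qed.
Next Obligation. by case: x. Qed.

Definition bD0 : bglob := @BGlob D0 (fun=> tt).

Definition pick0_fun (X : glob) (x : X 0) n : D0 n -> X n :=
  match n with 0 => fun=> x | k.+1 => fun z : void => match z with end end.
Program Definition pick0 (X : glob) (x : X 0) : gmap D0 X :=
  @GMap D0 X (pick0_fun x) _ _.
Next Obligation. by case: x0. Qed.
Next Obligation. by case: x0. Qed.

(** Colimits of globular sets are computed dimensionwise, and [D0]
    is empty above dimension 0; in dimension 0 the pushout of [X 0] and [Y 0]
    along a point is modelled by [X 0] plus the complement of the basepoint of
    [Y 0].  Lemma [wedge_pushout] is the universal property. *)

Section Wedge.
Variables X Y : bglob.

Definition wcell (n : nat) : Type :=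
  match n with
  | 0 => (X 0 + {y : Y 0 | y <> bpt Y vminus})%type
  | k.+1 => (X k.+1 + Y k.+1)%type
  end.

Definition winl n : X n -> wcell n :=
  match n with 0 => inl | k.+1 => inl end.

Definition winr0 (y : Y 0) : wcell 0 :=
  match pselect (y = bpt Y vminus) with
  | left _ => inl (bpt X vplus)
  | right h => inr (exist _ y h)
  end.

Definition winr n : Y n -> wcell n :=
  match n with 0 => winr0 | k.+1 => inr end.

Definition wsrc n (z : wcell n.+1) : wcell n :=
  match z with inl x => winl (src x) | inr y => winr (src y) end.
Definition wtgt n (z : wcell n.+1) : wcell n :=
  match z with inl x => winl (tgt x) | inr y => winr (tgt y) end.

Program Definition wedge_glob : glob := @Glob wcell wsrc wtgt _ _.
Next Obligation. by case: x => x /=; rewrite src_glob. Qed.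
Next Obligation. by case: x => x /=; rewrite tgt_glob. Qed.

Definition wedge : bglob :=
  @BGlob wedge_glob (fun e => match e with
    | vminus => winl (bpt X vminus) | vplus => winr (bpt Y vplus) end).

Definition wedgel : gmap X wedge := @GMap X wedge winl (fun _ _ => erefl) (fun _ _ => erefl).
Definition wedger : gmap Y wedge := @GMap Y wedge winr (fun _ _ => erefl) (fun _ _ => erefl).

Section Copair.
Variables (Z : glob) (f : gmap X Z) (g : gmap Y Z).
Hypothesis fg : f 0 (bpt X vplus) = g 0 (bpt Y vminus).

Definition wcopair_fun n : wedge n -> Z n :=
  match n with
  | 0 => fun z : wcell 0 =>
      match z with inl x => f 0 x | inr y => g 0 (sval y) end
  | k.+1 => fun z : wcell k.+1 =>
      match z with inl x => f k.+1 x | inr y => g k.+1 y end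
  end.

Lemma wcopairl n (x : X n) : wcopair_fun (winl x) = f n x.
Proof. by case: n x. Qed.

Lemma wcopairr n (y : Y n) : wcopair_fun (winr y) = g n y.
Proof. by case: n y => //= y; rewrite /winr0; case: pselect => //= ->. Qed.

Program Definition wcopair : gmap wedge Z := @GMap wedge Z wcopair_fun _ _.
Next Obligation.
by case: x => x /=; rewrite ?wcopairl ?wcopairr -gfun_src.
Qed.
Next Obligation.
by case: x => x /=; rewrite ?wcopairl ?wcopairr -gfun_tgt.
Qed.

Lemma wedge_pushout :
  [/\ gcomp wcopair wedgel = f, gcomp wcopair wedger = g &
      forall h : gmap wedge Z, gcomp h wedgel = f -> gcomp h wedger = g ->
        h = wcopair].
Proof.
split=> [||h hf hg]; apply: gmap_eq => n z /=; rewrite ?wcopairl ?wcopairr //.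
have el k (x : X k) : h k (winl x) = f k x by rewrite -hf.
have er k (y : Y k) : h k (winr y) = g k y by rewrite -hg.
case: n z => [|n] [z|z] /=; [exact: el 0 z| |exact: el n.+1 z|exact: er n.+1 z].
case: z => y yN; rewrite -(er 0 y) /= /winr0; case: pselect => //= h'.
by rewrite (Prop_irrelevance yN h').
Qed.

End Copair.

Lemma wedge_glue : wedgel 0 (bpt X vplus) = wedger 0 (bpt Y vminus).
Proof. by rewrite /= /winr0; case: pselect. Qed.

End Wedge.

Lemma wedgeM_glue X X' Y Y' (f : bgmap X X') (g : bgmap Y Y') :
  gcomp (wedgel X' Y') f 0 (bpt X vplus) = gcomp (wedger X' Y') g 0 (bpt Y vminus).
Proof.
rewrite -[LHS]/(wedgel X' Y' 0 (f 0 _)) -[RHS]/(wedger X' Y' 0 (g 0 _)).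
by rewrite !bgfun_pt wedge_glue.
Qed.

Program Definition wedgeM X X' Y Y' (f : bgmap X X') (g : bgmap Y Y') :
  bgmap (wedge X Y) (wedge X' Y') :=
  @BGMap (wedge X Y) (wedge X' Y') (wcopair (wedgeM_glue f g)) _.
Next Obligation.
case: e; first by rewrite /= bgfun_pt.
exact: etrans (wcopairr (wedgeM_glue f g) _) (congr1 (wedger X' Y' 0) (bgfun_pt g vplus)).
Qed.

(** The wedge of a one-element list is its entry on the nose. *)
Fixpoint wedges (s : seq bglob) : bglob :=
  match s with
  | [::] => bD0
  | X :: s' => match s' with [::] => X | _ => wedge X (wedges s') end
  end.

Section Susp.
Variable X : glob.

Definition susp_cell (n : nat) : Type := if n is k.+1 then X k else pole.

Definition susp_src n : susp_cell n.+1 -> susp_cell n :=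
  match n with 0 => fun=> vminus | k.+1 => src end.
Definition susp_tgt n : susp_cell n.+1 -> susp_cell n :=
  match n with 0 => fun=> vplus | k.+1 => tgt end.

Program Definition susp_glob : glob := @Glob susp_cell susp_src susp_tgt _ _.
Next Obligation. by case: n x => //= n x; rewrite src_glob. Qed.
Next Obligation. by case: n x => //= n x; rewrite tgt_glob. Qed.

Definition susp : bglob := @BGlob susp_glob (fun e => e).

End Susp.

Definition suspM_fun X Y (f : gmap X Y) n : susp X n -> susp Y n :=
  match n with 0 => fun e => e | k.+1 => f k end.

Program Definition suspM X Y (f : gmap X Y) : bgmap (susp X) (susp Y) :=
  @BGMap (susp X) (susp Y) (@GMap (susp X) (susp Y) (suspM_fun f) _ _)
    (fun=> erefl).
Next Obligation. by case: n x => //= n x; rewrite gfun_src. Qed.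
Next Obligation. by case: n x => //= n x; rewrite gfun_tgt. Qed.

Definition in_hom (X : bglob) n (x : X n) : Prop :=
  src0 x = bpt X vminus /\ tgt0 x = bpt X vplus.

Lemma in_hom_src (X : bglob) n (x : X n.+2) : in_hom x -> in_hom (src x).
Proof. by rewrite /in_hom => -[<- <-]; split; rewrite //= tgt_glob. Qed.

Lemma in_hom_tgt (X : bglob) n (x : X n.+2) : in_hom x -> in_hom (tgt x).
Proof. by rewrite /in_hom => -[<- <-]; split; rewrite //= src_glob. Qed.

Section Loop.
Variable X : bglob.

Definition loop_cell (n : nat) : Type := {x : X n.+1 | in_hom x}.

Lemma loop_cell_eq n (x y : loop_cell n) : sval x = sval y -> x = y.
Proof.
by case: x y => [x px] [y py] /= xy; subst y; rewrite (Prop_irrelevance px py).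
Qed.

Definition loop_src n (x : loop_cell n.+1) : loop_cell n :=
  exist _ (src (sval x)) (in_hom_src (svalP x)).

Definition loop_tgt n (x : loop_cell n.+1) : loop_cell n :=
  exist _ (tgt (sval x)) (in_hom_tgt (svalP x)).

Program Definition loop : glob := @Glob loop_cell loop_src loop_tgt _ _.
Next Obligation. by apply: loop_cell_eq; exact: src_glob. Qed.
Next Obligation. by apply: loop_cell_eq; exact: tgt_glob. Qed.

End Loop.

Lemma gfun_src0 (X Y : glob) (f : gmap X Y) n (x : X n) :
  f 0 (src0 x) = src0 (f n x).
Proof. by elim: n x => //= n IH x; rewrite IH gfun_src. Qed.

Lemma gfun_tgt0 (X Y : glob) (f : gmap X Y) n (x : X n) :
  f 0 (tgt0 x) = tgt0 (f n x).
Proof. by elim: n x => //= n IH x; rewrite IH gfun_tgt. Qed.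

Lemma bgmap_in_hom (X Y : bglob) (f : bgmap X Y) n (x : X n) :
  in_hom x -> in_hom (f n x).
Proof.
by move=> [xm xp]; split; rewrite -?gfun_src0 -?gfun_tgt0 ?xm ?xp bgfun_pt.
Qed.

Program Definition loopM (X Y : bglob) (f : bgmap X Y) : gmap (loop X) (loop Y) :=
  @GMap (loop X) (loop Y)
    (fun n x => exist _ (f n.+1 (sval x)) (bgmap_in_hom f (svalP x))) _ _.
Next Obligation. by apply: loop_cell_eq; exact: gfun_src. Qed.
Next Obligation. by apply: loop_cell_eq; exact: gfun_tgt. Qed.

(** Unit and counit of the adjunction between [susp] and [loop].  Since
    [loop (susp X)] consists of cells of [X] with a proof of [in_hom], the unit
    is the identity on underlying cells rather than an identity map. *)
Lemma susp_in_hom (X : glob) n (x : susp X n.+1) : in_hom x.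
Proof.
split; elim: n x => //= n IH x; exact: IH.
Qed.

Program Definition loop_unit (X : glob) : gmap X (loop (susp X)) :=
  @GMap X (loop (susp X)) (fun n x => exist _ x (@susp_in_hom X n x)) _ _.
Next Obligation. by apply: loop_cell_eq. Qed.
Next Obligation. by apply: loop_cell_eq. Qed.

Definition kappa_fun (X : bglob) n : susp (loop X) n -> X n :=
  match n with 0 => bpt X | k.+1 => fun x => sval x end.

Program Definition kappa (X : bglob) : bgmap (susp (loop X)) X :=
  @BGMap (susp (loop X)) X (@GMap (susp (loop X)) X (@kappa_fun X) _ _)
    (fun=> erefl).
Next Obligation. by case: n x => //= -[x [/= <- _]]. Qed.
Next Obligation. by case: n x => //= -[x [/= _ <-]]. Qed.

Inductive batanin := br of seq batanin.

Fixpoint dim (B : batanin) : nat :=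
  let: br s := B in foldr (fun B' d => maxn (dim B').+1 d) 0 s.

Fixpoint Pos (B : batanin) : bglob :=
  let: br s := B in wedges (map (fun B' => susp (Pos B')) s).

Fixpoint bd (k : nat) (B : batanin) : batanin :=
  match k with
  | 0 => br [::]
  | k'.+1 => let: br s := B in br (map (bd k') s)
  end.

(** The wedge of the suspensions of a family of maps [Pos (d B) -> Pos B]. *)
Fixpoint wedges_suspM (d : batanin -> batanin)
    (f : forall B, gmap (Pos (d B)) (Pos B)) (s : seq batanin) :
  bgmap (Pos (br (map d s))) (Pos (br s)) :=
  match s with
  | [::] => bgid bD0
  | B :: s' =>
    match s' return bgmap (Pos (br (map d s'))) (Pos (br s')) ->
        bgmap (Pos (br (map d (B :: s')))) (Pos (br (B :: s'))) with
    | [::] => fun=> suspM (f B)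
    | _ :: _ => fun r => wedgeM (suspM (f B)) r
    end (wedges_suspM f s')
  end.

(** [bdincl vminus k B] is the source inclusion s_k^B and [bdincl vplus k B]
    the target inclusion t_k^B. *)
Fixpoint bdincl (e : pole) (k : nat) : forall B, gmap (Pos (bd k B)) (Pos B) :=
  match k with
  | 0 => fun B => pick0 (bpt (Pos B) e)
  | k'.+1 => fun B => let: br s := B in wedges_suspM (bdincl e k') s
  end.

(** B |-> br [B]; definitionally Pos (tsusp B) = susp (Pos B). *)
Definition tsusp (B : batanin) : batanin := br [:: B].
Lemma Pos_tsusp B : Pos (tsusp B) = susp (Pos B). Proof. by []. Qed.
Lemma bdincl_tsusp e k B : bdincl e k.+1 (tsusp B) = suspM (bdincl e k B).
Proof. by []. Qed.

Lemma bd_dim k B : dim (bd k B) <= k.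
Proof.
elim: k B => [|k IH] [s] //=.
by elim: s => //= B s IHs; rewrite geq_max IHs ltnS IH.
Qed.

Lemma Pos_dim B k : dim B < k -> Pos B k -> False.
Proof.
move: B k; fix IH 1 => -[s] [|k] //=; rewrite ltnS.
elim: s => [_ []|B [|B' s] IHs].
  by rewrite /= maxn0 => hB; exact: IH B k hB.
rewrite [foldr _ _ _]/= geq_max => /andP[hB hs].
by case=> [p|p]; [exact: IH B k hB p | exact: IHs hs p].
Qed.

(** [level n] packages the data of the recursion in dimension n - 1:
    Comp_{n-1} with its morphisms, Free_{n-1}, Sph_{n-1}, supports and full
    spheres.  Cells of dimension n are defined over a level of index n. *)
Record level (n : nat) := Level {
  ncomp : Type;
  hom : ncomp -> ncomp -> Type;
  idh : forall C, hom C C;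
  mulh : forall C D E, hom D E -> hom C D -> hom C E;
  mulhA : forall C D E F (r : hom E F) (s : hom D E) (t : hom C D),
    mulh r (mulh s t) = mulh (mulh r s) t;
  mul1h : forall C D (s : hom C D), mulh (idh D) s = s;
  mulh1 : forall C D (s : hom C D), mulh s (idh C) = s;
  free : glob -> ncomp;
  freeM : forall X Y, gmap X Y -> hom (free X) (free Y);
  freeM1 : forall X, freeM (gid X) = idh (free X);
  freeMM : forall X Y Z (g : gmap Y Z) (f : gmap X Y),
    freeM (gcomp g f) = mulh (freeM g) (freeM f);
  sph : ncomp -> Type;
  sphM : forall C D, hom C D -> sph C -> sph D;
  sphM1 : forall C (A : sph C), sphM (idh C) A = A;
  sphMM : forall C D E (s : hom D E) (t : hom C D) (A : sph C),
    sphM (mulh s t) A = sphM s (sphM t A);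
  (* all generators of a computad, of any dimension < n *)
  gen : ncomp -> Type;
  homsupp : forall C D, hom C D -> gen D -> Prop;
  sphsupp : forall C, sph C -> gen C -> Prop;
  (* the attaching map x |-> (var (src x), var (tgt x)) of the free n-computad *)
  freesph : forall X : glob, X n -> sph (free X);
  freesphM : forall X Y (f : gmap X Y) (x : X n),
    sphM (freeM f) (freesph x) = freesph (f n x);
  freesph_glob : forall (X : glob) (x : X n.+1),
    freesph (src x) = freesph (tgt x);
  full : forall B, sph (free (Pos B)) -> Prop }.

Arguments ncomp {n} l.
Arguments hom {n l} C D.
Arguments idh {n l} C.
Arguments mulh {n l C D E} s t.
Arguments free {n} l X.
Arguments freeM {n} l {X Y} f.
Arguments sph {n l} C.
Arguments sphM {n l C D} s A.
Arguments gen {n l} C.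
Arguments homsupp {n l C D} s g.
Arguments sphsupp {n l C} A g.
Arguments freesph {n} l {X} x.
Arguments full {n} l {B} A.

(** The identity morphism along an equality of computads. *)
Definition idto n (L : level n) (C D : ncomp L) (e : C = D) : hom C D :=
  match e with erefl => idh C end.

Section LevelTheory.
Variables (n : nat) (L : level n).
Implicit Types C D E : ncomp L.

Lemma idto_refl C (e : C = C) : idto e = idh C.
Proof. by rewrite (Prop_irrelevance e erefl). Qed.

Lemma idtoK C D (e : C = D) : mulh (idto e) (idto (esym e)) = idh D.
Proof. by destruct e; rewrite mul1h. Qed.

Lemma idtoKV C D (e : C = D) : mulh (idto (esym e)) (idto e) = idh C.
Proof. by destruct e; rewrite mul1h. Qed.

Lemma homsupp_idto C D E (e : C = D) (s : hom C E) g :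
  homsupp s g -> homsupp (mulh s (idto (esym e))) g.
Proof. by destruct e; rewrite mulh1. Qed.

End LevelTheory.

(** Dimension -1: the terminal category, one sphere, and no full sphere, so
    that there are no coherence cells in dimension 0. *)
Program Definition level0 : level 0 :=
  @Level 0 unit (fun _ _ => unit) (fun=> tt) (fun _ _ _ _ _ => tt) _ _ _
    (fun=> tt) (fun _ _ _ => tt) _ _
    (fun=> unit) (fun _ _ _ _ => tt) _ _
    (fun=> void) (fun _ _ _ _ => False) (fun _ _ _ => False)
    (fun _ _ => tt) _ _ (fun _ _ => False).
Next Obligation. by []. Qed.
Next Obligation. by case: s. Qed.
Next Obligation. by case: s. Qed.
Next Obligation. by []. Qed.
Next Obligation. by []. Qed.
Next Obligation. by case: A. Qed.
Next Obligation. by []. Qed.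
Next Obligation. by []. Qed.
Next Obligation. by []. Qed.

Section Step.
Variables (n : nat) (L : level n).

Record scomp := SComp {
  cbase : ncomp L;
  cgen : Type;
  cbdry : cgen -> sph cbase }.

(** The boundary of coh(B, A, t) only involves A and the restriction of t to
    dimension n - 1.  Hence cells can be generated without the typing
    condition on t, and the cells are the hereditarily well-formed ones: the
    n-dimensional part [tV] of t is well-formed and compatible with boundaries.
    See [coh] and [cell_case] below. *)
Inductive raw (C : scomp) :=
| rvar of cgen C
| rcoh (B : batanin) (A : sph (free L (Pos B)))
       (t : hom (free L (Pos B)) (cbase C)) (tV : Pos B n -> raw C).

Definition rbdry C (c : raw C) : sph (cbase C) :=
  match c with rvar v => cbdry v | rcoh _ A t _ => sphM t A end.

Fixpoint wf C (c : raw C) : Prop :=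
  match c with
  | rvar _ => True
  | rcoh B A t tV =>
      [/\ dim B <= n, full L A &
          forall p, wf (tV p) /\ rbdry (tV p) = sphM t (freesph L p)]
  end.

Record cell (C : scomp) := Cell { rawc :> raw C; wfc : wf rawc }.

Definition bdry C (c : cell C) : sph (cbase C) := rbdry c.

Definition var C (v : cgen C) : cell C := @Cell C (rvar v) I.

Record shom (C D : scomp) := SHom {
  hbase : hom (cbase C) (cbase D);
  hgen : cgen C -> cell D;
  hbdry : forall v, bdry (hgen v) = sphM hbase (cbdry v) }.

Definition sfree (X : glob) : scomp := @SComp (free L X) (X n) (@freesph n L X).

Lemma coh_wf C B (A : sph (free L (Pos B))) (t : shom (sfree (Pos B)) C) :
  dim B <= n -> full L A ->
  wf (@rcoh C B A (hbase t) (fun p => rawc (hgen t p))).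
Proof. by split=> // p; split; [exact: wfc | exact: (hbdry t p)]. Qed.

Definition coh C B (A : sph (free L (Pos B))) (t : shom (sfree (Pos B)) C)
    (hB : dim B <= n) (hA : full L A) : cell C :=
  Cell (coh_wf t hB hA).

Lemma cell_eq C (c d : cell C) : rawc c = rawc d -> c = d.
Proof.
case: c d => [c hc] [d hd] /= cd; subst d; by rewrite (Prop_irrelevance hc hd).
Qed.

Lemma cell_case C (c : cell C) :
  (exists v, c = var v) \/
  (exists B (A : sph (free L (Pos B))) (t : shom (sfree (Pos B)) C) hB hA,
     c = @coh C B A t hB hA).
Proof.
case: c => -[v|B A t tV] h; first by left; exists v; exact: cell_eq.
right; case: (h) => hB hA hV; exists B, A.
have hV' (p : cgen (sfree (Pos B))) :
    bdry (Cell (proj1 (hV p))) = sphM t (@cbdry (sfree (Pos B)) p) by exact: (proj2 (hV p)).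
by exists (@SHom (sfree (Pos B)) C t (fun p => Cell (proj1 (hV p))) hV'), hB, hA; exact: cell_eq.
Qed.

Lemma bdry_coh C B A t hB hA :
  bdry (@coh C B A t hB hA) = sphM (hbase t) A.
Proof. by []. Qed.

Lemma shom_eq C D (s t : shom C D) :
  hbase s = hbase t -> (forall v, hgen s v = hgen t v) -> s = t.
Proof.
case: s t => [s sV hs] [t tV ht] /= st /funext stV; subst t tV.
by rewrite (Prop_irrelevance hs ht).
Qed.

Fixpoint rawM C D (s : shom C D) (c : raw C) : raw D :=
  match c with
  | rvar v => hgen s v
  | rcoh B A t tV => @rcoh D B A (mulh (hbase s) t) (fun p => rawM s (tV p))
  end.

Lemma rbdry_rawM C D (s : shom C D) c : rbdry (rawM s c) = sphM (hbase s) (rbdry c).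
Proof. by case: c => [v|B A t tV] /=; [exact: hbdry | rewrite sphMM]. Qed.

Lemma rawM_wf C D (s : shom C D) c : wf c -> wf (rawM s c).
Proof.
elim: c => [v _|B A t tV IH [hB hA hV]] /=; first exact: wfc.
split=> // p; have [wfp bp] := hV p; split; first exact: IH.
by rewrite rbdry_rawM bp sphMM.
Qed.

Definition cellM C D (s : shom C D) (c : cell C) : cell D :=
  Cell (rawM_wf s (wfc c)).

Lemma bdry_cellM C D (s : shom C D) c : bdry (cellM s c) = sphM (hbase s) (bdry c).
Proof. exact: rbdry_rawM. Qed.

Lemma cellM_var C D (s : shom C D) v : cellM s (var v) = hgen s v.
Proof. exact: cell_eq. Qed.

Definition sidh C : shom C C :=
  @SHom C C (idh _) (@var C) (fun v => esym (sphM1 (cbdry v))).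

Lemma smulh_bdry C D E (s : shom D E) (t : shom C D) v :
  bdry (cellM s (hgen t v)) = sphM (mulh (hbase s) (hbase t)) (cbdry v).
Proof. by rewrite bdry_cellM hbdry sphMM. Qed.

Definition smulh C D E (s : shom D E) (t : shom C D) : shom C E :=
  @SHom C E (mulh (hbase s) (hbase t)) (fun v => cellM s (hgen t v))
    (smulh_bdry s t).

Lemma cellM1 C (c : cell C) : cellM (sidh C) c = c.
Proof.
apply: cell_eq => /=; case: c => /= c _.
by elim: c => //= B A t tV IH; rewrite mul1h; congr rcoh; exact: funext.
Qed.

Lemma cellMM C D E (s : shom D E) (t : shom C D) c :
  cellM (smulh s t) c = cellM s (cellM t c).
Proof.
apply: cell_eq => /=; case: c => /= c _.
elim: c => //= B A r rV IH; rewrite mulhA; congr rcoh; exact: funext.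
Qed.

Lemma cellM_coh C D (s : shom C D) B A t hB hA :
  cellM s (@coh C B A t hB hA) = @coh D B A (smulh s t) hB hA.
Proof. exact: cell_eq. Qed.

Lemma smulhA C D E F (r : shom E F) (s : shom D E) (t : shom C D) :
  smulh r (smulh s t) = smulh (smulh r s) t.
Proof. by apply: shom_eq => /= [|v]; rewrite ?mulhA ?cellMM. Qed.

Lemma smul1h C D (s : shom C D) : smulh (sidh D) s = s.
Proof. by apply: shom_eq => /= [|v]; rewrite ?mul1h ?cellM1. Qed.

Lemma smulh1 C D (s : shom C D) : smulh s (sidh C) = s.
Proof. by apply: shom_eq => /= [|v]; rewrite ?mulh1 ?cellM_var. Qed.

Lemma sfreeM_bdry X Y (f : gmap X Y) (x : X n) :
  @bdry (sfree Y) (@var (sfree Y) (f n x)) = sphM (freeM L f) (freesph L x).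
Proof. by rewrite freesphM. Qed.

Definition sfreeM X Y (f : gmap X Y) : shom (sfree X) (sfree Y) :=
  @SHom (sfree X) (sfree Y) (freeM L f) (fun x : X n => @var (sfree Y) (f n x))
    (sfreeM_bdry f).

Lemma sfreeM1 X : sfreeM (gid X) = sidh (sfree X).
Proof. by apply: shom_eq => //=; rewrite freeM1. Qed.

Lemma sfreeMM X Y Z (g : gmap Y Z) (f : gmap X Y) :
  sfreeM (gcomp g f) = smulh (sfreeM g) (sfreeM f).
Proof. by apply: shom_eq => /= [|x]; rewrite ?freeMM ?cellM_var. Qed.

Record ssph (C : scomp) := SSph {
  pr1 : cell C;
  pr2 : cell C;
  prE : bdry pr1 = bdry pr2 }.

Lemma ssph_eq C (A A' : ssph C) : pr1 A = pr1 A' -> pr2 A = pr2 A' -> A = A'.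
Proof.
case: A A' => [a b h] [a' b' h'] /= aa bb; subst a' b'.
by rewrite (Prop_irrelevance h h').
Qed.

Lemma ssphM_subproof C D (s : shom C D) (A : ssph C) :
  bdry (cellM s (pr1 A)) = bdry (cellM s (pr2 A)).
Proof. by rewrite !bdry_cellM prE. Qed.

Definition ssphM C D (s : shom C D) (A : ssph C) : ssph D :=
  SSph (ssphM_subproof s A).

Lemma ssphM1 C (A : ssph C) : ssphM (sidh C) A = A.
Proof. by apply: ssph_eq => /=; rewrite cellM1. Qed.

Lemma ssphMM C D E (s : shom D E) (t : shom C D) (A : ssph C) :
  ssphM (smulh s t) A = ssphM s (ssphM t A).
Proof. by apply: ssph_eq => /=; rewrite cellMM. Qed.

Definition sgen (C : scomp) : Type := (gen (cbase C) + cgen C)%type.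

Fixpoint rsupp C (c : raw C) (g : sgen C) : Prop :=
  match c with
  | rvar v =>
      match g with inl h => sphsupp (cbdry v) h | inr w => w = v end
  | rcoh B A t tV =>
      match g with inl h => homsupp t h | inr _ => False end \/
      exists p, rsupp (tV p) g
  end.

Definition supp C (c : cell C) (g : sgen C) : Prop := rsupp c g.

(** The union of the supports of the images of all generators of [C], of any
    dimension; for the argument of a coherence cell, this is its support. *)
Definition shomsupp C D (s : shom C D) (g : sgen D) : Prop :=
  match g with inl h => homsupp (hbase s) h | inr _ => False end \/
  exists v, supp (hgen s v) g.

Lemma supp_coh C B A t hB hA g :
  supp (@coh C B A t hB hA) g <-> shomsupp t g.
Proof. by []. Qed.

Definition ssphsupp C (A : ssph C) (g : sgen C) : Prop :=
  supp (pr1 A) g \/ supp (pr2 A) g.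

Lemma sfreesph_subproof (X : glob) (x : X n.+1) :
  @bdry (sfree X) (@var (sfree X) (src x)) = @bdry (sfree X) (@var (sfree X) (tgt x)).
Proof. exact: freesph_glob. Qed.

Definition sfreesph (X : glob) (x : X n.+1) : ssph (sfree X) :=
  SSph (sfreesph_subproof x).

Lemma sfreesphM X Y (f : gmap X Y) (x : X n.+1) :
  ssphM (sfreeM f) (sfreesph x) = sfreesph (f n.+1 x).
Proof. by apply: ssph_eq => /=; rewrite cellM_var /= (gfun_src, gfun_tgt). Qed.

Lemma sfreesph_glob (X : glob) (x : X n.+2) : sfreesph (src x) = sfreesph (tgt x).
Proof. by apply: ssph_eq => /=; rewrite (src_glob, tgt_glob). Qed.

(** The generators of [sfree (Pos (bd n B))] are all the positions of
    [bd n B], since dim (bd n B) <= n; cf. [Pos_dim] and [bd_dim]. *)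
Definition sfull B (A : ssph (sfree (Pos B))) : Prop :=
  exists a b : cell (sfree (Pos (bd n B))),
    [/\ pr1 A = cellM (sfreeM (bdincl vminus n B)) a,
        pr2 A = cellM (sfreeM (bdincl vplus n B)) b,
        forall g, supp a g &
        forall g, supp b g].

Definition step : level n.+1 :=
  @Level n.+1 scomp shom sidh smulh smulhA smul1h smulh1
    sfree sfreeM sfreeM1 sfreeMM ssph ssphM ssphM1 ssphMM
    sgen shomsupp ssphsupp sfreesph sfreesphM sfreesph_glob sfull.

End Step.

Arguments coh {n L C} B A t hB hA.

Fixpoint lvl (n : nat) : level n :=
  match n with 0 => level0 | k.+1 => step (lvl k) end.

(** The suspension functor from dimension n - 1 to dimension n, its action on
    spheres, and the equality Sigma Free = Free Sigma.  The remaining fields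
    describe supports, and serve to show that fullness is preserved. *)
Record susplevel n (L : level n) (L' : level n.+1) := SuspLevel {
  sig : ncomp L -> ncomp L';
  sigM : forall C D, hom C D -> hom (sig C) (sig D);
  sigM1 : forall C, sigM (idh C) = idh (sig C);
  sigMM : forall C D E (s : hom D E) (t : hom C D),
    sigM (mulh s t) = mulh (sigM s) (sigM t);
  sigsph : forall C, sph C -> sph (sig C);
  sigsphM : forall C D (s : hom C D) (A : sph C),
    sphM (sigM s) (sigsph A) = sigsph (sphM s A);
  sigfree : forall X, sig (free L X) = free L' (susp X);
  sigfree_sph : forall (X : glob) (x : X n),
    sphM (idto (sigfree X)) (sigsph (freesph L x)) = @freesph _ L' (susp X) x;
  sigfree_nat : forall X Y (f : gmap X Y),
    mulh (idto (sigfree Y)) (sigM (freeM L f)) =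
    mulh (freeM L' (suspM f)) (idto (sigfree X));
  siggen : forall C, gen C -> gen (sig C);
  sigpt : forall C, pole -> gen (sig C);
  siggenP : forall C (g : gen (sig C)),
    (exists e, g = sigpt C e) \/ (exists h, g = siggen h);
  homsupp_gen : forall C D (s : hom C D) g,
    homsupp s g -> homsupp (sigM s) (siggen g);
  homsupp_pt : forall C D (s : hom C D) e, homsupp (sigM s) (sigpt D e);
  sphsupp_gen : forall C (A : sph C) g,
    sphsupp A g -> sphsupp (sigsph A) (siggen g);
  sphsupp_pt : forall C (A : sph C) e, sphsupp (sigsph A) (sigpt C e);
  sigfull : forall B (A : sph (free L (Pos B))), full L A ->
    @full _ L' (tsusp B) (sphM (idto (sigfree (Pos B))) (sigsph A)) }.

Arguments sig {n L L'} _ C.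
Arguments sigM {n L L'} _ {C D} _.
Arguments sigsph {n L L'} _ {C} A.
Arguments siggen {n L L'} _ {C} _.
Arguments sigpt {n L L'} _ C _.

Section SCompEq.
Variables (n : nat) (L : level n) (C D : ncomp L) (V : Type).
Variables (phi : V -> sph C) (psi : V -> sph D) (e : C = D).
Hypothesis h : forall v, sphM (idto e) (phi v) = psi v.

Lemma scomp_eq : SComp phi = SComp psi.
Proof.
by destruct e; congr SComp; apply: funext => v; rewrite -h sphM1.
Qed.

Lemma idto_scomp (E : SComp phi = SComp psi :> ncomp (step L)) :
  hbase (idto E) = idto e /\ forall v, hgen (idto E) v = @var n L (SComp psi) v.
Proof.
destruct e; have phipsi : phi = psi by apply: funext => v; rewrite -h sphM1.
by move: E; rewrite -phipsi => E; rewrite idto_refl.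
Qed.

End SCompEq.

Definition pt2 : ncomp (step level0) := @SComp 0 level0 tt pole (fun=> tt).

Definition pt2sph : sph pt2 :=
  @SSph 0 level0 pt2 (@var 0 level0 pt2 vminus) (@var 0 level0 pt2 vplus) erefl.

Lemma pt2_free (X : glob) : pt2 = free (step level0) (susp X).
Proof. exact: (@scomp_eq 0 level0 tt tt _ _ _ erefl). Qed.

Lemma idto_pt2 (X : glob) v :
  hgen (idto (pt2_free X)) v = @var 0 level0 (free (step level0) (susp X)) v.
Proof. exact: (proj2 (@idto_scomp 0 level0 tt tt _ _ _ erefl _ (pt2_free X))). Qed.

Lemma pt2_free_sph (X : glob) (x : X 0) :
  sphM (idto (pt2_free X)) pt2sph = @freesph 1 (step level0) (susp X) x.
Proof. by apply: ssph_eq; rewrite /= cellM_var idto_pt2. Qed.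

Lemma pt2_free_nat X Y (f : gmap X Y) :
  mulh (idto (pt2_free Y)) (idh pt2) =
  mulh (freeM (step level0) (suspM f)) (idto (pt2_free X)).
Proof.
apply: shom_eq => [|v]; first by case: (hbase _); case: (hbase _).
by rewrite /= cellM_var !idto_pt2 cellM_var.
Qed.

Lemma pt2_gen (g : gen pt2) : (exists e, g = inr e) \/ (exists h : void, g = inl h).
Proof. by case: g => [[]|e]; left; exists e. Qed.

Lemma pt2_homsupp e : homsupp (idh pt2) (inr e).
Proof. by right; exists e. Qed.

Lemma pt2_sphsupp e : sphsupp pt2sph (inr e).
Proof. by case: e; [left | right]. Qed.

Definition susplevel0 : susplevel level0 (step level0) :=
  @SuspLevel 0 level0 (step level0) (fun=> pt2) (fun _ _ _ => idh pt2)
    (fun=> erefl) (fun _ _ _ _ _ => esym (mul1h (idh pt2)))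
    (fun _ _ => pt2sph) (fun _ _ _ _ => sphM1 pt2sph)
    pt2_free pt2_free_sph pt2_free_nat
    (fun _ (h : void) => inl h) (fun _ e => inr e) (fun _ => pt2_gen)
    (fun _ _ _ (h : void) => match h with end) (fun _ _ _ => pt2_homsupp)
    (fun _ _ (h : void) => match h with end) (fun _ _ => pt2_sphsupp)
    (fun _ _ h => match h with end).

Section SuspStep.
Variables (n : nat) (L : level n) (L' : level n.+1) (S : susplevel L L').

Definition ssig (C : scomp L) : scomp L' :=
  @SComp n.+1 L' (sig S (cbase C)) (cgen C) (fun v => sigsph S (cbdry v)).

(** The typing of [rcoh] uses that [Pos (tsusp B) n.+1] is [Pos B n]. *)
Fixpoint rsig (C : scomp L) (c : raw C) : raw (ssig C) :=
  match c with
  | rvar v => @rvar n.+1 L' (ssig C) v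
  | rcoh B A t tV =>
      @rcoh n.+1 L' (ssig C) (tsusp B)
        (sphM (idto (sigfree S (Pos B))) (sigsph S A))
        (mulh (sigM S t) (idto (esym (sigfree S (Pos B)))))
        (fun p => rsig (tV p))
  end.

Lemma rbdry_rsig C (c : raw C) : rbdry (rsig c) = sigsph S (rbdry c).
Proof.
case: c => //= B A t tV.
by rewrite -sphMM -mulhA idtoKV mulh1 sigsphM.
Qed.

Lemma dim_tsusp B : dim (tsusp B) = (dim B).+1.
Proof. by rewrite /= maxn0. Qed.

Lemma rsig_wf C (c : raw C) : wf c -> wf (rsig c).
Proof.
elim: c => //= B A t tV IH [hB hA hV]; split.
- by rewrite maxn0.
- exact: (sigfull S hA).
- move=> p; have [wp bp] := hV p; split; first exact: IH.
  by rewrite rbdry_rsig bp -(sigfree_sph S) -sphMM -mulhA idtoKV mulh1 sigsphM.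
Qed.

Definition sigcell (C : scomp L) (c : cell C) : cell (ssig C) :=
  Cell (rsig_wf (wfc c)).

Lemma bdry_sigcell C (c : cell C) : bdry (sigcell c) = sigsph S (bdry c).
Proof. exact: rbdry_rsig. Qed.

Lemma ssigM_subproof C D (s : shom C D) v :
  bdry (sigcell (hgen s v)) = sphM (sigM S (hbase s)) (@cbdry _ _ (ssig C) v).
Proof. by rewrite bdry_sigcell hbdry -sigsphM. Qed.

Definition ssigM C D (s : shom C D) : shom (ssig C) (ssig D) :=
  @SHom _ _ (ssig C) (ssig D) (sigM S (hbase s)) (fun v => sigcell (hgen s v))
    (ssigM_subproof s).

Lemma sigcellM C D (s : shom C D) c :
  cellM (ssigM s) (sigcell c) = sigcell (cellM s c).
Proof.
apply: cell_eq => /=; case: c => /= c _; elim: c => //= B A t tV IH.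
by rewrite sigMM mulhA; congr rcoh; apply: funext.
Qed.

Lemma ssigM1 C : ssigM (sidh C) = sidh (ssig C).
Proof. by apply: shom_eq => /= [|v]; rewrite ?sigM1 //; exact: cell_eq. Qed.

Lemma ssigMM C D E (s : shom D E) (t : shom C D) :
  ssigM (smulh s t) = smulh (ssigM s) (ssigM t).
Proof. by apply: shom_eq => /= [|v]; rewrite ?sigMM ?sigcellM. Qed.

Lemma ssigsph_subproof C (A : ssph C) :
  bdry (sigcell (pr1 A)) = bdry (sigcell (pr2 A)).
Proof. by rewrite !bdry_sigcell prE. Qed.

Definition ssigsph C (A : ssph C) : ssph (ssig C) :=
  SSph (ssigsph_subproof A).

Lemma ssigsphM C D (s : shom C D) (A : ssph C) :
  ssphM (ssigM s) (ssigsph A) = ssigsph (ssphM s A).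
Proof. by apply: ssph_eq; exact: sigcellM. Qed.

Lemma ssigfree X : ssig (sfree L X) = sfree L' (susp X).
Proof. exact: (scomp_eq (e := sigfree S X) (sigfree_sph S (X := X))). Qed.

Notation sfcast X := (@idto _ (step L') _ _ (ssigfree X)).

Lemma hbase_ssigfree X : hbase (sfcast X) = idto (sigfree S X).
Proof. exact: (proj1 (idto_scomp (sigfree_sph S (X := X)) (ssigfree X))). Qed.

Lemma hgen_ssigfree X v : hgen (sfcast X) v = @var _ _ (sfree L' (susp X)) v.
Proof. exact: (proj2 (idto_scomp (sigfree_sph S (X := X)) (ssigfree X))). Qed.

Lemma sigcell_var C (v : cgen C) : sigcell (var v) = @var _ _ (ssig C) v.
Proof. exact: cell_eq. Qed.

Lemma ssigfree_sph (X : glob) (x : X n.+1) :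
  sphM (sfcast X) (ssigsph (sfreesph L x)) = @sfreesph _ L' (susp X) x.
Proof. by apply: ssph_eq; rewrite /= sigcell_var cellM_var hgen_ssigfree. Qed.

Lemma ssigfree_nat X Y (f : gmap X Y) :
  mulh (sfcast Y) (ssigM (sfreeM L f)) =
  mulh (freeM (step L') (suspM f)) (sfcast X).
Proof.
apply: shom_eq => /= [|v].
  rewrite -[LHS]/(mulh (hbase (sfcast Y)) _) -[RHS]/(mulh _ (hbase (sfcast X))).
  by rewrite !hbase_ssigfree sigfree_nat.
apply: etrans (congr1 (cellM (sfcast Y)) (sigcell_var (C := sfree L Y) _)) _.
rewrite cellM_var; apply: etrans (hgen_ssigfree (X := Y) (f n v)) _.
apply: etrans (esym (congr1 (cellM (sfreeM L' (suspM f))) (hgen_ssigfree (X := X) v))).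
by rewrite cellM_var.
Qed.

Definition ssiggen C (g : sgen C) : sgen (ssig C) :=
  match g with inl h => inl (siggen S h) | inr v => inr v end.

Definition ssigpt C (e : pole) : sgen (ssig C) := inl (sigpt S (cbase C) e).

Lemma ssiggenP C (g : sgen (ssig C)) :
  (exists e, g = ssigpt C e) \/ (exists h, g = ssiggen h).
Proof.
case: g => [g|v]; last by right; exists (inr v).
have [[e ->]|[h ->]] := siggenP g; first by left; exists e.
by right; exists (inl h).
Qed.

Lemma rsupp_gen C (c : raw C) g : rsupp c g -> rsupp (rsig c) (ssiggen g).
Proof.
elim: c => [v|B A t tV IH] /=; first by case: g => //= h; exact: sphsupp_gen.
case=> [h|[p hp]]; last by right; exists p; exact: IH.
by left; case: g h {IH} => //= h hh; apply/homsupp_idto/homsupp_gen.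
Qed.

Lemma rsupp_pt C (c : raw C) e : rsupp (rsig c) (ssigpt C e).
Proof.
case: c => [v|B A t tV] /=; first exact: sphsupp_pt.
by left; apply/homsupp_idto/homsupp_pt.
Qed.

Lemma shomsupp_gen C D (s : shom C D) g :
  shomsupp s g -> shomsupp (ssigM s) (ssiggen g).
Proof.
case=> [h|[v hv]]; last by right; exists v; exact: rsupp_gen.
by left; case: g h => //= h; exact: homsupp_gen.
Qed.

Lemma shomsupp_pt C D (s : shom C D) e : shomsupp (ssigM s) (ssigpt D e).
Proof. by left; exact: homsupp_pt. Qed.

Lemma ssphsupp_gen C (A : ssph C) g :
  ssphsupp A g -> ssphsupp (ssigsph A) (ssiggen g).
Proof. by case=> h; [left | right]; exact: rsupp_gen. Qed.

Lemma ssphsupp_pt C (A : ssph C) e : ssphsupp (ssigsph A) (ssigpt C e).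
Proof. by left; exact: rsupp_pt. Qed.

Lemma supp_idto (C D : ncomp (step L')) (e : C = D) (c : cell C) :
  (forall g, supp c g) -> forall g, supp (cellM (idto e) c) g.
Proof. by destruct e; rewrite cellM1. Qed.

Lemma supp_sigcell_full C (c : cell C) :
  (forall g, supp c g) -> forall g, supp (sigcell c) g.
Proof.
move=> hc g; have [[e ->]|[h ->]] := ssiggenP g; first exact: rsupp_pt.
apply: rsupp_gen; exact: hc.
Qed.

Lemma sigcell_freeM X Y (f : gmap X Y) (c : cell (sfree L X)) :
  cellM (sfcast Y) (sigcell (cellM (sfreeM L f) c)) =
  cellM (sfreeM L' (suspM f)) (cellM (sfcast X) (sigcell c)).
Proof.
rewrite -sigcellM -!cellMM.
by have /= := ssigfree_nat f; rewrite /mulh /= => ->.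
Qed.

Lemma ssigfull B (A : ssph (sfree L (Pos B))) : sfull A ->
  @sfull _ L' (tsusp B) (sphM (sfcast (Pos B)) (ssigsph A)).
Proof.
move=> [a [b [ha hb sa sb]]].
exists (cellM (sfcast (Pos (bd n B))) (sigcell a)).
exists (cellM (sfcast (Pos (bd n B))) (sigcell b)).
split.
- by rewrite /= ha sigcell_freeM.
- by rewrite /= hb sigcell_freeM.
- exact: supp_idto (supp_sigcell_full sa).
- exact: supp_idto (supp_sigcell_full sb).
Qed.

Definition suspstep : susplevel (step L) (step L') :=
  @SuspLevel n.+1 (step L) (step L') ssig ssigM ssigM1 ssigMM ssigsph ssigsphM
    ssigfree ssigfree_sph ssigfree_nat ssiggen ssigpt ssiggenP
    shomsupp_gen shomsupp_pt ssphsupp_gen ssphsupp_pt ssigfull.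

End SuspStep.

Fixpoint slvl (n : nat) : susplevel (lvl n) (lvl n.+1) :=
  match n with 0 => susplevel0 | k.+1 => suspstep (slvl k) end.

Section SuspCoh.
Variables (n : nat) (L : level n) (L' : level n.+1) (S : susplevel L L').

Lemma ssigfreeV X :
  hbase (idto (L := step L') (esym (ssigfree S X))) = idto (esym (sigfree S X)) /\
  forall v : X n, hgen (idto (L := step L') (esym (ssigfree S X))) v =
    @var _ _ (ssig S (sfree L X)) v.
Proof.
have h (v : X n) : sphM (idto (esym (sigfree S X))) (@freesph _ L' (susp X) v) =
    sigsph S (freesph L v).
  by rewrite -(sigfree_sph S) -sphMM idtoKV sphM1.
exact: (idto_scomp h (esym (ssigfree S X))).
Qed.

Lemma sigcell_coh (C : scomp L) B (A : sph (free L (Pos B)))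
    (t : shom (sfree L (Pos B)) C) hB hA hB' hA' :
  sigcell S (coh B A t hB hA) =
  coh (C := ssig S C) (tsusp B) (sphM (idto (sigfree S (Pos B))) (sigsph S A))
    (smulh (ssigM S t) (idto (L := step L') (esym (ssigfree S (Pos B))))) hB' hA'.
Proof.
have [hb hg] := ssigfreeV (Pos B).
apply: cell_eq; rewrite /= hb; congr rcoh; apply: funext => p.
by rewrite (hg p).
Qed.

End SuspCoh.

(** Sequences start in dimension -1: [trunc C n] is the (n-1)-computad C_{n-1}. *)
Record computad := Computad {
  trunc : forall n, ncomp (lvl n);
  truncE : forall n, @cbase n (lvl n) (trunc n.+1) = trunc n }.

(** Compatibility of a sequence of morphisms with the forgetful functors,
    along the identifications [truncE]. *)
Record cmap (C D : computad) := CMap {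
  ctrunc : forall n, hom (trunc C n) (trunc D n);
  ctruncE : forall n,
    mulh (idto (truncE D n)) (@hbase n (lvl n) _ _ (ctrunc n.+1)) =
    mulh (ctrunc n) (idto (truncE C n)) }.

Section CellGlob.
Variable C : computad.

Definition Cell_cell (n : nat) : Type := @cell n (lvl n) (trunc C n.+1).

Definition Cell_bdry n (c : Cell_cell n.+1) : @ssph n (lvl n) (trunc C n.+1) :=
  ssphM (idto (truncE C n.+1)) (bdry c).

Lemma Cell_bdryE n (c d : Cell_cell n.+1) : bdry c = bdry d -> Cell_bdry c = Cell_bdry d.
Proof. by rewrite /Cell_bdry => ->. Qed.

Lemma Cell_prE n (c : Cell_cell n.+2) :
  Cell_bdry (pr1 (Cell_bdry c)) = Cell_bdry (pr2 (Cell_bdry c)).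
Proof. exact: (Cell_bdryE (prE (Cell_bdry c))). Qed.

Definition CellG : glob :=
  @Glob Cell_cell (fun n c => pr1 (Cell_bdry c)) (fun n c => pr2 (Cell_bdry c))
    (fun n c => congr1 (@pr1 _ _ _) (Cell_prE c))
    (fun n c => congr1 (@pr2 _ _ _) (Cell_prE c)).

End CellGlob.

Section CellMap.
Variables (C D : computad) (s : cmap C D).

Lemma Cell_bdryM n (c : CellG C n.+1) :
  @Cell_bdry D n (@cellM n.+1 (lvl n.+1) _ _ (ctrunc s n.+2) c) =
  ssphM (ctrunc s n.+1) (Cell_bdry c).
Proof.
rewrite /Cell_bdry bdry_cellM.
have := congr1 (fun u => sphM u (bdry c)) (ctruncE s n.+1).
by rewrite !sphMM.
Qed.

Definition CellGM : gmap (CellG C) (CellG D) :=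
  @GMap (CellG C) (CellG D) (fun n c => cellM (ctrunc s n.+1) c)
    (fun n c => esym (congr1 (@pr1 _ _ _) (Cell_bdryM c)))
    (fun n c => esym (congr1 (@pr2 _ _ _) (Cell_bdryM c))).

End CellMap.

Definition Free (X : glob) : computad :=
  @Computad (fun n => free (lvl n) X) (fun n => erefl).

Lemma FreeM_subproof X Y (f : gmap X Y) n :
  mulh (idto (truncE (Free Y) n)) (@hbase n (lvl n) _ _ (freeM (lvl n.+1) f)) =
  mulh (freeM (lvl n) f) (idto (truncE (Free X) n)).
Proof. by rewrite /= mul1h mulh1. Qed.

Definition FreeM X Y (f : gmap X Y) : cmap (Free X) (Free Y) :=
  @CMap (Free X) (Free Y) (fun n => freeM (lvl n) f) (FreeM_subproof f).

Definition T (X : glob) : glob := CellG (Free X).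
Definition TM X Y (f : gmap X Y) : gmap (T X) (T Y) := CellGM (FreeM f).

Lemma eta_bdry (X : glob) n (x : X n.+1) :
  @Cell_bdry (Free X) n (@var n.+1 (lvl n.+1) (free (lvl n.+2) X) x) =
  sfreesph (lvl n) x.
Proof. exact: (sphM1 (l := lvl n.+1) (C := free (lvl n.+1) X)). Qed.

Definition eta (X : glob) : gmap X (T X) :=
  @GMap X (T X) (fun n x => @var n (lvl n) (free (lvl n.+1) X) x)
    (fun n x => esym (congr1 (@pr1 _ _ _) (eta_bdry x)))
    (fun n x => esym (congr1 (@pr2 _ _ _) (eta_bdry x))).

(** The counit Free (Cell C) -> C, the identity on generators; by recursion on
    the dimension, with the compatibility needed for the next step. *)
Section Counit.
Variable C : computad.

Definition Cell_sph n : CellG C n -> sph (trunc C n) :=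
  fun c => sphM (idto (truncE C n)) (bdry c).

Definition eps_spec n (h : hom (free (lvl n) (CellG C)) (trunc C n)) : Prop :=
  forall c : CellG C n, sphM h (freesph (lvl n) c) = Cell_sph c.

Lemma eps_step_bdry n (h : hom (free (lvl n) (CellG C)) (trunc C n))
  (hP : eps_spec h) (c : CellG C n) :
  @bdry n (lvl n) (trunc C n.+1) c =
  sphM (mulh (idto (esym (truncE C n))) h) (freesph (lvl n) c).
Proof. by rewrite sphMM hP /Cell_sph -sphMM idtoKV sphM1. Qed.

Definition eps_step n (h : hom (free (lvl n) (CellG C)) (trunc C n))
    (hP : eps_spec h) : hom (free (lvl n.+1) (CellG C)) (trunc C n.+1) :=
  @SHom n (lvl n) (free (lvl n.+1) (CellG C)) (trunc C n.+1)
    (mulh (idto (esym (truncE C n))) h) (fun c => c) (eps_step_bdry hP).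

Lemma eps_stepP n (h : hom (free (lvl n) (CellG C)) (trunc C n))
  (hP : eps_spec h) : eps_spec (eps_step hP).
Proof. by move=> c; apply: ssph_eq; exact: cellM_var. Qed.

Definition eps0 : hom (free (lvl 0) (CellG C)) (trunc C 0) := tt.

Lemma eps0P : eps_spec eps0.
Proof. by move=> c; case: (Cell_sph c). Qed.

Fixpoint eps_rec (n : nat) :
  {h : hom (free (lvl n) (CellG C)) (trunc C n) | eps_spec h} :=
  match n with
  | 0 => exist _ eps0 eps0P
  | k.+1 => exist _ (eps_step (svalP (eps_rec k))) (eps_stepP (svalP (eps_rec k)))
  end.

Lemma epsE n :
  mulh (idto (truncE C n)) (@hbase n (lvl n) _ _ (sval (eps_rec n.+1))) =
  mulh (sval (eps_rec n)) (idto (truncE (Free (CellG C)) n)).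
Proof. by rewrite /= mulhA idtoK mul1h mulh1. Qed.

Definition eps : cmap (Free (CellG C)) C :=
  @CMap (Free (CellG C)) C (fun n => sval (eps_rec n)) epsE.

Lemma eps_gen n (c : CellG C n) :
  @hgen n (lvl n) (free (lvl n.+1) (CellG C)) _ (ctrunc eps n.+1) c = c.
Proof. by []. Qed.

Lemma eps_base n : @hbase n (lvl n) _ _ (ctrunc eps n.+1) =
  mulh (idto (esym (truncE C n))) (ctrunc eps n).
Proof. by []. Qed.

End Counit.

Lemma eps_nat C D (s : cmap C D) n :
  mulh (ctrunc (eps D) n) (freeM (lvl n) (CellGM s)) =
  mulh (ctrunc s n) (ctrunc (eps C) n).
Proof.
elim: n => [|n IH]; first by case: (mulh _ _); case: (mulh _ _).
apply: shom_eq => [|c]; last first.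
  exact: (etrans (@cellM_var _ _ (free (lvl n.+1) (CellG D)) _ (ctrunc (eps D) n.+1) _)).
rewrite -[LHS]/(mulh (mulh _ (ctrunc (eps D) n)) (freeM _ _)).
rewrite -[RHS]/(mulh (@hbase n (lvl n) _ _ (ctrunc s n.+1)) (mulh _ (ctrunc (eps C) n))).
rewrite -mulhA IH !mulhA; congr mulh.
have := congr1 (fun u => mulh (idto (esym (truncE D n))) (mulh u (idto (esym (truncE C n))))) (ctruncE s n).
rewrite -!mulhA idtoK mulh1 => <-.
by rewrite !mulhA idtoKV mul1h.
Qed.

Definition mu (X : glob) : gmap (T (T X)) (T X) := CellGM (eps (Free X)).

Record omegacat := OmegaCat {
  ocar :> glob;
  oact : gmap (T ocar) ocar;
  oact_eta : gcomp oact (eta ocar) = gid ocar;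
  oact_mu : gcomp oact (mu ocar) = gcomp oact (TM oact) }.

Record omap (X Y : omegacat) := OMap {
  ofun :> gmap X Y;
  ofunE : gcomp ofun (oact X) = gcomp (oact Y) (TM ofun) }.

Definition oiso (X Y : omegacat) : Prop :=
  exists (f : omap X Y) (g : omap Y X), gcomp g f = gid X /\ gcomp f g = gid Y.

Lemma KT_eta C : gcomp (CellGM (eps C)) (eta (CellG C)) = gid (CellG C).
Proof.
by apply: gmap_eq => n c; exact: (@cellM_var _ _ (free (lvl n.+1) (CellG C))).
Qed.

Lemma KT_mu C :
  gcomp (CellGM (eps C)) (mu (CellG C)) =
  gcomp (CellGM (eps C)) (TM (CellGM (eps C))).
Proof.
apply: gmap_eq => n c; rewrite /= -!cellMM.
by have /= := eps_nat (eps C) n.+1; rewrite /mulh /= => ->.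
Qed.

Definition KT (C : computad) : omegacat :=
  @OmegaCat (CellG C) (CellGM (eps C)) (KT_eta C) (KT_mu C).

Record bcomputad := BComputad { bccar :> computad; bcpt : pole -> CellG bccar 0 }.

Record bomegacat := BOmegaCat { bocar :> omegacat; bopt : pole -> bocar 0 }.

(** The comparison functor of T**: an algebra of T** is an algebra of T with two
    0-cells. *)
Definition KTss (C : bcomputad) : bomegacat :=
  @BOmegaCat (KT C) (bcpt C).

Definition Tss (X : bglob) : bglob :=
  @BGlob (T X) (fun e => eta X 0 (bpt X e)).

Program Definition TssM (X Y : bglob) (f : bgmap X Y) : bgmap (Tss X) (Tss Y) :=
  @BGMap (Tss X) (Tss Y) (TM f) _.
Next Obligation.
apply: etrans (@cellM_var _ _ (free (lvl 1) X) _ _ _) _.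
by rewrite /= bgfun_pt.
Qed.

(** [SigT X] is Sigma^T : Sigma T X -> T** Sigma X, whose components in
    positive dimension are Sigma^Cell at Free_n X followed by the
    identification Sigma Free_n X = Free_{n+1} Sigma X. *)
Section SigT.
Variable X : glob.

Lemma T_bdry n (c : T X n.+1) :
  @Cell_bdry (Free X) n c = @bdry n.+1 (lvl n.+1) (free (lvl n.+2) X) c.
Proof. exact: (sphM1 (l := lvl n.+1) (C := free (lvl n.+1) X)). Qed.

Definition SigT_hom n : hom (sig (slvl n) (free (lvl n) X)) (free (lvl n.+1) (susp X)) :=
  idto (sigfree (slvl n) X).

Definition SigT_cell n (c : T X n) : T (susp X) n.+1 :=
  cellM (SigT_hom n.+1) (sigcell (slvl n) c).

Definition SigT_fun n : susp (T X) n -> T (susp X) n :=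
  match n with 0 => fun e => eta (susp X) 0 e | k.+1 => @SigT_cell k end.

Lemma SigT_bdry n (c : T X n) :
  Cell_bdry (SigT_cell c) = sphM (SigT_hom n) (sigsph (slvl n) (bdry c)).
Proof.
apply: etrans (sphM1 (l := lvl n.+1) (C := free (lvl n.+1) (susp X)) _) _.
apply: etrans (bdry_cellM (SigT_hom n.+1) (sigcell (slvl n) c)) _.
by rewrite bdry_sigcell (hbase_ssigfree (slvl n)).
Qed.

Lemma SigT_src n (x : susp (T X) n.+1) : SigT_fun (src x) = src (SigT_fun x).
Proof.
case: n x => [|n] x; apply: (etrans _ (esym (congr1 (@pr1 _ _ _) (SigT_bdry x)))).
  by rewrite /= cellM_var (idto_pt2 X).
exact: (congr1 (fun A => @SigT_cell n (@pr1 n (lvl n) _ A)) (T_bdry x)).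
Qed.

Lemma SigT_tgt n (x : susp (T X) n.+1) : SigT_fun (tgt x) = tgt (SigT_fun x).
Proof.
case: n x => [|n] x; apply: (etrans _ (esym (congr1 (@pr2 _ _ _) (SigT_bdry x)))).
  by rewrite /= cellM_var (idto_pt2 X).
exact: (congr1 (fun A => @SigT_cell n (@pr2 n (lvl n) _ A)) (T_bdry x)).
Qed.

Definition SigT : bgmap (susp (T X)) (Tss (susp X)) :=
  @BGMap (susp (T X)) (Tss (susp X))
    (@GMap (susp (T X)) (T (susp X)) SigT_fun SigT_src SigT_tgt) (fun=> erefl).

End SigT.

Definition OmegaT (X : bglob) : gmap (T (loop X)) (loop (Tss X)) :=
  gcomp (loopM (TssM (kappa X))) (gcomp (loopM (SigT (loop X))) (loop_unit (T (loop X)))).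

Definition bobglob (X : bomegacat) : bglob := @BGlob X (@bopt X).

Lemma boact_pt (X : bomegacat) e : oact X 0 (bpt (Tss (bobglob X)) e) = bpt (bobglob X) e.
Proof. exact: (congr1 (fun f : gmap X X => f 0 (bopt X e)) (oact_eta X)). Qed.

Definition boact (X : bomegacat) : bgmap (Tss (bobglob X)) (bobglob X) :=
  @BGMap (Tss (bobglob X)) (bobglob X) (oact X) (@boact_pt X).

Definition hom_act (X : bomegacat) : gmap (T (loop (bobglob X))) (loop (bobglob X)) :=
  gcomp (loopM (boact X)) (OmegaT (bobglob X)).

Lemma gmap_congr (X Y : glob) (f g : gmap X Y) n (x : X n) : f = g -> f n x = g n x.
Proof. by move=> ->. Qed.

Lemma OmegaT_var (X : bglob) n (x : loop X n) :
  sval (OmegaT X n (eta (loop X) n x)) = eta X n.+1 (sval x).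
Proof.
rewrite /= /SigT_cell.
have e1 := @sigcell_var n (lvl n) (lvl n.+1) (slvl n) (free (lvl n.+1) (loop X)) x.
apply: etrans (congr1 (fun c => cellM _ (cellM _ c)) e1) _.
rewrite cellM_var.
have e2 := @hgen_ssigfree n (lvl n) (lvl n.+1) (slvl n) (loop X) x.
apply: etrans (congr1 (cellM _) e2) _.
exact: (@cellM_var n.+1 (lvl n.+1) (free (lvl n.+2) (susp (loop X)))).
Qed.

Lemma hom_eta (X : bomegacat) :
  gcomp (hom_act X) (eta (loop (bobglob X))) = gid (loop (bobglob X)).
Proof.
apply: gmap_eq => n x; apply: loop_cell_eq.
apply: etrans (congr1 (oact X n.+1) (OmegaT_var x)) _.
exact: (gmap_congr (sval x) (oact_eta X)).
Qed.

(** The transpose Sigma T Omega X -> T** X of [OmegaT X]. *)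
Definition theta (X : bglob) : bgmap (susp (T (loop X))) (Tss X) :=
  bgcomp (TssM (kappa X)) (SigT (loop X)).

Lemma OmegaTE (X : bglob) n (c : T (loop X) n) :
  sval (OmegaT X n c) = theta X n.+1 c.
Proof. by []. Qed.

Definition theta_hom (X : bglob) n :
    hom (sig (slvl n) (free (lvl n) (loop X))) (free (lvl n.+1) X) :=
  mulh (freeM (lvl n.+1) (kappa X)) (SigT_hom (loop X) n).

Lemma thetaE (X : bglob) n (c : T (loop X) n) :
  theta X n.+1 c = cellM (theta_hom X n.+1) (sigcell (slvl n) c).
Proof. by rewrite /= /theta_hom /mulh /= cellMM. Qed.

Lemma theta_eps (X : bglob) n :
  mulh (ctrunc (eps (Free X)) n.+1)
    (mulh (freeM (lvl n.+1) (theta X)) (SigT_hom (T (loop X)) n)) =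
  mulh (theta_hom X n) (sigM (slvl n) (ctrunc (eps (Free (loop X))) n)).
Proof.
have eps_theta k (c : susp (T (loop X)) k) :
    cellM (ctrunc (eps (Free X)) k.+1) (cellM (freeM (lvl k.+1) (theta X))
      (@var k (lvl k) (free (lvl k.+1) (susp (T (loop X)))) c)) = theta X k c.
  rewrite [X in cellM _ X](@cellM_var k (lvl k)).
  exact: (@cellM_var k (lvl k) (free (lvl k.+1) (T X))).
elim: n => [|n IH]; apply: shom_eq => [|c].
- by case: (hbase _); case: (hbase _).
- rewrite -[LHS]/(cellM (ctrunc (eps (Free X)) 1)
    (cellM (freeM (lvl 1) (theta X)) (hgen (SigT_hom (T (loop X)) 0) c))).
  rewrite (idto_pt2 (T (loop X)) c) eps_theta.
  rewrite -[RHS]/(cellM (theta_hom X 0) (@var 0 level0 pt2 c)) cellM_var.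
  exact: esym (congr1 (cellM (freeM (lvl 1) (kappa X))) (idto_pt2 (loop X) c)).
- have hb Y : hbase (SigT_hom Y n.+1) = SigT_hom Y n by exact: hbase_ssigfree.
  rewrite -[LHS]/(mulh (mulh (idh (free (lvl n.+1) X)) (ctrunc (eps (Free X)) n.+1))
    (mulh (freeM (lvl n.+1) (theta X)) (hbase (SigT_hom (T (loop X)) n.+1)))).
  rewrite -[RHS]/(mulh (mulh (freeM (lvl n.+1) (kappa X))
      (hbase (SigT_hom (loop X) n.+1)))
    (sigM (slvl n) (mulh (idh (free (lvl n) (loop X))) (ctrunc (eps (Free (loop X))) n)))).
  by rewrite !hb !mul1h IH.
- rewrite -[LHS]/(cellM (ctrunc (eps (Free X)) n.+2)
    (cellM (freeM (lvl n.+2) (theta X)) (hgen (SigT_hom (T (loop X)) n.+1) c))).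
  have e := @hgen_ssigfree n (lvl n) (lvl n.+1) (slvl n) (T (loop X)) c.
  apply: etrans (congr1 (fun u => cellM (ctrunc (eps (Free X)) n.+2)
    (cellM (freeM (lvl n.+2) (theta X)) u)) e) _.
  by rewrite (eps_theta n.+1 c) thetaE.
Qed.

Lemma hom_actE (X : bomegacat) n (c : T (loop (bobglob X)) n) :
  sval (hom_act X n c) = oact X n.+1 (theta (bobglob X) n.+1 c).
Proof. by []. Qed.

Lemma kappa_hom_act (X : bomegacat) :
  gcomp (kappa (bobglob X)) (suspM (hom_act X)) = gcomp (oact X) (theta (bobglob X)).
Proof.
apply: gmap_eq => -[|n] c //.
rewrite -[LHS]/(bpt (bobglob X) c) -[RHS]/(oact X 0 (theta (bobglob X) 0 c)).
by rewrite -(boact_pt X c) -(bgfun_pt (theta (bobglob X)) c).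
Qed.

Lemma theta_hom_nat (X : bomegacat) n :
  mulh (theta_hom (bobglob X) n) (sigM (slvl n) (freeM (lvl n) (hom_act X))) =
  mulh (freeM (lvl n.+1) (oact X)) (mulh (freeM (lvl n.+1) (theta (bobglob X)))
    (SigT_hom (T (loop (bobglob X))) n)).
Proof.
rewrite /theta_hom -mulhA (sigfree_nat (slvl n)) !mulhA -!freeMM.
by rewrite kappa_hom_act.
Qed.

Lemma hom_mu (X : bomegacat) :
  gcomp (hom_act X) (mu (loop (bobglob X))) =
  gcomp (hom_act X) (TM (hom_act X)).
Proof.
apply: gmap_eq => n c; apply: loop_cell_eq.
pose u := cellM (mulh (freeM (lvl n.+2) (theta (bobglob X)))
    (SigT_hom (T (loop (bobglob X))) n.+1)) (sigcell (slvl n) c).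
have el : theta (bobglob X) n.+1 (mu (loop (bobglob X)) n c) = mu X n.+1 u.
  rewrite thetaE -[mu _ n c]/(cellM (ctrunc (eps (Free (loop (bobglob X)))) n.+1) c).
  rewrite -sigcellM -cellMM.
  rewrite -[mu X n.+1 u]/(cellM (ctrunc (eps (Free (bobglob X))) n.+2) u) /u -cellMM.
  exact: esym (congr1 (fun s => cellM s (sigcell (slvl n) c)) (theta_eps (bobglob X) n.+1)).
have er : theta (bobglob X) n.+1 (TM (hom_act X) n c) = TM (oact X) n.+1 u.
  rewrite thetaE -[TM _ n c]/(cellM (freeM (lvl n.+1) (hom_act X)) c).
  rewrite -sigcellM -cellMM.
  rewrite -[TM _ n.+1 u]/(cellM (freeM (lvl n.+2) (oact X)) u) /u -cellMM.
  exact: (congr1 (fun s => cellM s (sigcell (slvl n) c)) (theta_hom_nat X n.+1)).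
rewrite -[LHS]/(oact X n.+1 (theta (bobglob X) n.+1 (mu (loop (bobglob X)) n c))) el.
rewrite -[RHS]/(oact X n.+1 (theta (bobglob X) n.+1 (TM (hom_act X) n c))) er.
have e := congr1 (fun h : gmap (T (T X)) X => h n.+1 u) (oact_mu X); exact: e.
Qed.

Definition homcat (X : bomegacat) : omegacat :=
  @OmegaCat (loop (bobglob X)) (hom_act X) (hom_eta X) (hom_mu X).

(* Main.v *)
From mathcomp Require Import ssreflect ssrfun ssrbool ssrnat boolp.
Require Import Defs.

(** A coherence cell coh(B, A, t) of the hom omega-category acts in C as the
    suspended coherence coh(Sigma B, Sigma A, t'), where t' transposes t.  So
    the cells of the hom that the algebra structure produces from others are
    those of the form coh(Sigma B, Sigma A, t') with A full.  All remaining
    cells from c_- to c_+, namely the generators of C, the coherences over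
    trees with zero or several branches, and the coherences over some Sigma B
    whose sphere is not the suspension of a full one, cannot be decomposed,
    and they are the generators of a computad D with K D = Omega K C.

    The computad D is built one dimension at a time, together with a morphism
    phi : Sigma D -> C that sends v_- and v_+ to the basepoints of C and each
    generator to the cell that it is.  A generator needs an attaching sphere in
    the part of D already built: its boundary in C has to come from a sphere
    of D through A |-> phi (Sigma A).  This transposition is injective on
    cells ([transpose_cell_inj]), because Sigma is injective and because a
    suspended coherence is never a generator.  It reaches every cell with
    boundary in its image ([transpose_cell_onto]), because a suspended
    coherence with such a boundary has its whole argument in the image, so
    that the subcells can be decomposed in turn.  A cell of C of positive
    dimension has its boundary in the image exactly when it goes from c_- to
    c_+ ([to_hom_in], [in_hom_to_hom]).

    Hence transposition is a bijection from the cells of D onto those of the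
    hom.  It is a morphism of algebras because the equation
    phi . Sigma eps_D = eps_C . Free kappa . Sigma (Free f), with f the
    bijection and Sigma Free identified with Free Sigma, can be tested on
    generators ([transpose_eps]); and a bijective morphism of algebras is an
    isomorphism ([bijective_oiso]). *)

Set Implicit Arguments.
Unset Strict Implicit.
Unset Printing Implicit Defensive.

(** * Injectivity of the coherence constructor *)

Section CohInjectivity.
Variables (n : nat) (L : level n) (C : scomp L).

Lemma rcoh_inj_tree B B' (A : sph (free L (Pos B))) (A' : sph (free L (Pos B')))
    (t : hom _ (cbase C)) (t' : hom _ (cbase C)) tV tV' :
  rcoh A t tV = rcoh A' t' tV' -> B = B'.
Proof.
exact: (congr1 (fun c => if c is rcoh B2 _ _ _ then B2 else B)).
Qed.

Lemma rcoh_inj B (A A' : sph (free L (Pos B))) (t t' : hom _ (cbase C)) tV tV' :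
  rcoh A t tV = rcoh A' t' tV' -> [/\ A = A', t = t' & tV = tV'].
Proof.
(* A and A' live over the same tree only after inversion, so the conclusion is
   first stated up to transport along an equality of trees. *)
move=> e; pose castto B2 (eB : B2 = B) (P : batanin -> Type) (x : P B2) : P B :=
  eq_rect B2 P x B eB.
pose Q (c : raw C) := match c with
    | rvar _ => True
    | rcoh B2 A2 t2 tV2 => forall eB : B2 = B,
        [/\ A = castto B2 eB (fun B => sph (free L (Pos B))) A2,
            t = castto B2 eB (fun B => hom (free L (Pos B)) (cbase C)) t2 &
            tV = castto B2 eB (fun B => Pos B n -> raw C) tV2]
    end.
have : Q (rcoh A' t' tV').
  by rewrite -e => eB; rewrite (Prop_irrelevance eB erefl).
by move/(_ erefl).
Qed.

End CohInjectivity.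

(** * Transposition along a morphism from a suspension *)

Section Transpose.
Variables (n : nat) (L : level n) (L' : level n.+1) (S : susplevel L L').

(** Injectivity of the transposition s |-> phi . Sigma s, on spheres and on
    morphisms.  At the identity of Sigma D it says that Sigma is injective. *)
Definition separates (D : ncomp L) (E : ncomp L') (phi : hom (sig S D) E) : Prop :=
  injective (fun A : sph D => sphM phi (sigsph S A)) /\
  forall C, injective (fun t : hom C D => mulh phi (sigM S t)).

(** A morphism t : Sigma C -> E factors through phi as soon as a single
    suspended sphere does.  In dimension -1 the only sphere of C is sent to the
    pair (t v_-, t v_+), so that this is the condition that t preserve
    basepoints; a sphere of higher dimension remembers that pair as its
    iterated source and target. *)
Definition lifts (D : ncomp L) (E : ncomp L') (phi : hom (sig S D) E) : Prop :=
  forall C (t : hom (sig S C) E) (A : sph C) (A' : sph D),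
    sphM t (sigsph S A) = sphM phi (sigsph S A') ->
    exists t0 : hom C D, t = mulh phi (sigM S t0).

Lemma separates_idto D E E' (e : E = E') (phi : hom (sig S D) E) :
  separates phi -> separates (mulh (idto e) phi).
Proof. by destruct e; rewrite mul1h. Qed.

Lemma lifts_idto D E E' (e : E = E') (phi : hom (sig S D) E) :
  lifts phi -> lifts (mulh (idto e) phi).
Proof. by destruct e; rewrite mul1h. Qed.

End Transpose.

Section TransposeStep.
Variables (n : nat) (L : level n) (L' : level n.+1) (S : susplevel L L').

(** The spheres that the coherences in the image of the suspension carry.
    Fullness is required of A itself, since it is A that has to serve as the
    sphere of a coherence one dimension lower. *)
Inductive susp_full : forall B, sph (free L' (Pos B)) -> Prop :=
| SuspFull B (A : sph (free L (Pos B))) : full L A ->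
    @susp_full (tsusp B) (sphM (idto (sigfree S (Pos B))) (sigsph S A)).

Definition indecomposable (E : scomp L') (c : raw E) : Prop :=
  match c with rvar _ => True | rcoh _ A _ _ => ~ susp_full A end.

Section Separation.
Variables (D : scomp L) (E : scomp L') (phi : shom (ssig S D) E).
Hypothesis phi_base : separates (hbase phi).
Hypothesis susp_inj :
  forall B, injective (fun A : sph (free L (Pos B)) => sigsph S A).
Hypothesis phi_gen : injective (hgen phi).
Hypothesis phi_ind : forall v, indecomposable (hgen phi v).

(** The transpose of a coherence is a suspended coherence, hence differs from
    the image of every generator; comparing two transposed coherences reduces
    to the injectivity of Sigma on their spheres, of transposition on their
    lower-dimensional arguments, and to the induction hypothesis.
    Well-formedness supplies the fullness in [susp_full]. *)
Lemma transpose_raw_inj (c d : raw D) : wf c -> wf d ->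
  rawM phi (rsig S c) = rawM phi (rsig S d) -> c = d.
Proof.
elim: c d => [v|B A t tV IH] [w|B' A' t' tV'] /=.
- by move=> _ _ /cell_eq/phi_gen ->.
- move=> _ [_ fA' _] e; have := phi_ind v; rewrite e /=; case; exact: SuspFull.
- move=> [_ fA _] _ e; have := phi_ind w; rewrite -e /=; case; exact: SuspFull.
move=> [_ _ wV] [_ _ wV'] e.
have [eB] := rcoh_inj_tree e; subst B'.
have [eA et eV] := rcoh_inj e.
have {}eA : A = A'.
  move: eA => /(congr1 (sphM (idto (esym (sigfree S (Pos B)))))).
  by rewrite -!sphMM idtoKV !sphM1; exact: susp_inj.
have {}et : t = t'.
  move: et => /(congr1 (fun u => mulh u (idto (sigfree S (Pos B))))).
  rewrite -!mulhA idtoKV !mulh1; exact: (proj2 phi_base).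
have {}eV : tV = tV'.
  apply: funext => p; apply: IH (proj1 (wV p)) (proj1 (wV' p)) _.
  exact: (congr1 (fun u => u p) eV).
by rewrite eA et eV.
Qed.

Lemma transpose_cell_inj : injective (fun c : cell D => cellM phi (sigcell S c)).
Proof.
move=> c d e; apply: cell_eq; apply: transpose_raw_inj (wfc c) (wfc d) _.
exact: (congr1 (@rawc _ _ _) e).
Qed.

Lemma separates_step : separates (S := suspstep S) (phi : @hom _ (step L') _ _).
Proof.
split=> [A A' e|C t t' e].
  apply: ssph_eq; apply: transpose_cell_inj.
  - exact: (congr1 (@pr1 _ _ _) e).
  - exact: (congr1 (@pr2 _ _ _) e).
apply: shom_eq => [|v].
  by apply: (proj2 phi_base); exact: (congr1 (@hbase _ _ _ _) e).
apply: transpose_cell_inj.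
exact: (congr1 (fun s : shom _ _ => @hgen _ _ (ssig S C) _ s v) e).
Qed.

End Separation.

Section Lifting.
Variables (D : scomp L) (E : scomp L') (phi : shom (ssig S D) E).
Hypothesis phi_sep : separates (hbase phi).
Hypothesis phi_lift : lifts (hbase phi).
Hypothesis phi_gen : forall (c : cell E) (A : sph (cbase D)),
  bdry c = sphM (hbase phi) (sigsph S A) -> indecomposable c ->
  exists v, hgen phi v = c.

(** Structural induction on the cell.  Only a suspended coherence
    coh(Sigma B, Sigma A, t) needs an argument: its boundary t (Sigma A) is in
    the image of transposition, so t has a transpose t0 below the top dimension
    by [lifts]; hence the top-dimensional subcells have boundary in the image
    too, and the induction hypothesis applies to them. *)
Lemma transpose_cell_onto (c : cell E) (A : sph (cbase D)) :
  bdry c = sphM (hbase phi) (sigsph S A) ->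
  exists d : cell D, cellM phi (sigcell S d) = c.
Proof.
case: c => c wc; rewrite /bdry /=.
suff H : rbdry c = sphM (hbase phi) (sigsph S A) ->
    exists d : cell D, rawM phi (rsig S d) = c.
  by move=> /H[d hd]; exists d; exact: cell_eq.
elim: c A wc => [v|B A t tV IH] A' wc bc.
  have [v' hv] := phi_gen (c := Cell wc) bc I.
  by exists (@var _ _ D v'); rewrite /= hv.
have [fA|fA] := pselect (susp_full A); last first.
  have [v' hv] := phi_gen (c := Cell wc) bc fA.
  by exists (@var _ _ D v'); rewrite /= hv.
case: B A / fA t tV IH wc bc => B A fA t tV IH [dB _ wV] /=.
rewrite -sphMM => bc.
have [t0 e0] := phi_lift bc.
have et : t = mulh (mulh (hbase phi) (sigM S t0)) (idto (esym (sigfree S (Pos B)))).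
  by rewrite -e0 -mulhA idtoK mulh1.
have bV (p : Pos B n) : rbdry (tV p) =
    sphM (hbase phi) (sigsph S (sphM t0 (freesph L p))).
  by rewrite (proj2 (wV p)) -(sigfree_sph S) -sphMM e0 sphMM sigsphM.
have /choice[tV0 eV] : forall p : Pos B n,
    exists d : cell D, rawM phi (rsig S d) = tV p.
  by move=> p; exact: IH p _ (proj1 (wV p)) (bV p).
have bV0 (p : Pos B n) : bdry (tV0 p) = sphM t0 (freesph L p).
  apply: (proj1 phi_sep); rewrite /= -bV -eV rbdry_rawM /=.
  by rewrite rbdry_rsig.
have dB' : dim B <= n by move: dB; rewrite dim_tsusp.
pose t1 : shom (sfree L (Pos B)) D := @SHom _ _ (sfree L (Pos B)) D t0 tV0 bV0.
exists (coh (C := D) B A t1 dB' fA).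
rewrite /= mulhA -et; congr rcoh; exact: funext.
Qed.

(** The boundary of the given sphere provides the factorisation of t below the
    top dimension, which forces the boundaries of the values of t on generators
    into the image of transposition; these values then lift by
    [transpose_cell_onto]. *)
Lemma lifts_step : lifts (S := suspstep S) (phi : @hom _ (step L') _ _).
Proof.
move=> C t A A' e.
have e1 : sphM (hbase t) (sigsph S (bdry (pr1 A))) =
    sphM (hbase phi) (sigsph S (bdry (pr1 A'))).
  have := congr1 (fun X => bdry (pr1 X)) e.
  by rewrite /= !bdry_cellM !bdry_sigcell.
have [t0 e0] := phi_lift e1.
have bt v : bdry (hgen t v) = sphM (hbase phi) (sigsph S (sphM t0 (@cbdry _ L C v))).
  by rewrite hbdry e0 sphMM sigsphM.
have /choice[tV eV] := fun v => transpose_cell_onto (bt v).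
have bV v : bdry (tV v) = sphM t0 (@cbdry _ L C v).
  apply: (proj1 phi_sep); rewrite /= -bt -eV.
  by rewrite bdry_cellM bdry_sigcell.
exists (@SHom n L C D t0 tV bV); apply: shom_eq => [|v] /=; first exact: e0.
by rewrite eV.
Qed.

End Lifting.

(** * The generators of the hom *)

Section Generators.
Variables (D : ncomp L) (E : scomp L') (phi : hom (sig S D) (cbase E)).

Definition loop_gen : Type :=
  {c : cell E | indecomposable c /\ exists A, bdry c = sphM phi (sigsph S A)}.

(** The attaching sphere is chosen; it is unique once phi separates spheres. *)
Definition loop_scomp : scomp L :=
  @SComp n L D loop_gen (fun v => sval (cid (proj2 (svalP v)))).

Definition loop_transpose : shom (ssig S loop_scomp) E :=
  @SHom _ _ (ssig S loop_scomp) E phi (fun v => sval v)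
    (fun v => svalP (cid (proj2 (svalP v)))).

Hypothesis phi_sep : separates phi.
Hypothesis phi_lift : lifts phi.
Hypothesis susp_inj :
  forall B, injective (fun A : sph (free L (Pos B)) => sigsph S A).

Lemma loop_transpose_gen_inj : injective (hgen loop_transpose).
Proof.
by move=> [c hc] [d hd] /= cd; subst d; rewrite (Prop_irrelevance hc hd).
Qed.

Lemma loop_transpose_sep :
  separates (S := suspstep S) (loop_transpose : @hom _ (step L') _ _).
Proof.
apply: separates_step loop_transpose_gen_inj _ => // v.
exact: proj1 (svalP v).
Qed.

Lemma loop_transpose_inj :
  injective (fun c : cell loop_scomp => cellM loop_transpose (sigcell S c)).
Proof.
apply: transpose_cell_inj loop_transpose_gen_inj _ => // v.
exact: proj1 (svalP v).
Qed.

Lemma loop_transpose_gen_onto (c : cell E) (A : sph D) :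
  bdry c = sphM phi (sigsph S A) -> indecomposable c ->
  exists v, hgen loop_transpose v = c.
Proof.
by move=> bc ic; exists (exist _ c (conj ic (ex_intro _ A bc))).
Qed.

Lemma loop_transpose_lift :
  lifts (S := suspstep S) (loop_transpose : @hom _ (step L') _ _).
Proof.
exact: (lifts_step (phi := loop_transpose)
  phi_sep phi_lift loop_transpose_gen_onto).
Qed.

Lemma loop_transpose_onto (c : cell E) (A : sph D) :
  bdry c = sphM phi (sigsph S A) ->
  exists d : cell loop_scomp, cellM loop_transpose (sigcell S d) = c.
Proof.
exact: (transpose_cell_onto (phi := loop_transpose)
  phi_sep phi_lift loop_transpose_gen_onto).
Qed.

End Generators.
End TransposeStep.

(** The identity of Sigma C sends generators to generators, so that the general
    step applies to it with no further condition. *)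
Lemma separates_idh n (C : ncomp (lvl n)) : separates (idh (sig (slvl n) C)).
Proof.
elim: n C => [|n IH] C; first by split=> [[] [] //|D [] []].
apply: (@separates_step _ _ _ (slvl n) C (ssig (slvl n) C) (sidh _)).
- exact: IH.
- by move=> B A A' e; apply: (proj1 (IH _)); rewrite /= e.
- by move=> v w [].
- by [].
Qed.

Lemma sigsph_inj n (C : ncomp (lvl n)) : injective (@sigsph _ _ _ (slvl n) C).
Proof. by move=> A A' e; apply: (proj1 (separates_idh C)); rewrite /= e. Qed.

(** * The computad and its comparison with the hom *)

Section LoopComputad.
Variable C : bcomputad.

(** The computad D truncated below dimension n, with its morphism from the
    suspension; the two have to be built by a common recursion, since phi
    determines the generators of the next dimension. *)
Record stage n := Stage {
  stage_comp : ncomp (lvl n);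
  stage_map : hom (sig (slvl n) stage_comp) (trunc C n.+1) }.

Lemma stage0_bdry (v : pole) :
  @bdry 0 level0 (trunc C 1) (bcpt C v) = tt.
Proof. by case: (bdry _). Qed.

Definition stage0 : stage 0 :=
  @Stage 0 tt (@SHom 0 level0 pt2 (trunc C 1) tt (fun v : pole => bcpt C v) stage0_bdry).

Definition stageS n (s : stage n) : stage n.+1 :=
  let phi := mulh (idto (esym (truncE C n.+1))) (stage_map s) in
  @Stage n.+1 (loop_scomp phi) (loop_transpose phi).

Fixpoint stages n : stage n :=
  match n with 0 => stage0 | k.+1 => stageS (stages k) end.

Definition loop_computad : computad :=
  @Computad (fun n => stage_comp (stages n)) (fun=> erefl).

Notation D := loop_computad.
Notation X := (bobglob (KTss C)).

Definition transpose n : hom (sig (slvl n) (trunc D n)) (trunc C n.+1) :=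
  stage_map (stages n).

Definition transpose_base n : hom (sig (slvl n) (trunc D n)) (cbase (trunc C n.+2)) :=
  mulh (idto (esym (truncE C n.+1))) (transpose n).

Lemma transpose_bij n : separates (transpose n) /\ lifts (transpose n).
Proof.
elim: n => [|n [sep lift]].
  split; first by split=> [[] [] //|E [] []].
  move=> E t A A' e; exists tt; apply: shom_eq => [|v].
    by case: (hbase _); case: (hbase _).
  have := congr1 (fun B => if v is vminus then pr1 B else pr2 B) e.
  by case: v => /=; rewrite !cellM_var => ->.
have sep' := separates_idto (esym (truncE C n.+1)) sep.
have lift' := lifts_idto (e := esym (truncE C n.+1)) lift.
by split; [apply: loop_transpose_sep => // B; exact: sigsph_inj
          |exact: loop_transpose_lift].
Qed.

(** On cells, the adjoint transpose of phi : Sigma D -> C. *)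
Definition to_hom n (c : CellG D n) : CellG C n.+1 :=
  cellM (transpose n.+1) (sigcell (slvl n) c).

Lemma to_hom_bdry n (c : CellG D n) :
  Cell_bdry (to_hom c) = sphM (transpose n) (sigsph (slvl n) (bdry c)).
Proof.
rewrite /Cell_bdry /to_hom bdry_cellM bdry_sigcell.
rewrite -[ssphM _ _]/(sphM (idto (truncE C n.+1)) _) -sphMM.
by rewrite -[hbase _]/(transpose_base n) /transpose_base mulhA idtoK mul1h.
Qed.

Lemma to_hom_inj n : injective (@to_hom n).
Proof.
apply: loop_transpose_inj => [|B]; last exact: sigsph_inj.
exact: separates_idto (proj1 (transpose_bij n)).
Qed.

Lemma to_hom_onto n (c : CellG C n.+1) (A : sph (trunc D n)) :
  Cell_bdry c = sphM (transpose n) (sigsph (slvl n) A) ->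
  exists d, to_hom d = c.
Proof.
move=> bc; have [sep lift] := transpose_bij n.
apply: (loop_transpose_onto (separates_idto _ sep) (lifts_idto lift) (A := A)).
rewrite sphMM -bc -[Cell_bdry c]/(sphM (idto (truncE C n.+1)) _).
by rewrite -sphMM idtoKV sphM1.
Qed.

Lemma loop_bdry n (c : CellG D n.+1) : Cell_bdry c = bdry c.
Proof. exact: (sphM1 (l := lvl n.+1) (C := trunc D n.+1)). Qed.

Lemma to_hom_src n (c : CellG D n.+1) : to_hom (src c) = src (to_hom c).
Proof.
rewrite -[RHS]/(pr1 (Cell_bdry (to_hom c))) to_hom_bdry.
by rewrite -[src c]/(pr1 (Cell_bdry c)) loop_bdry.
Qed.

Lemma to_hom_tgt n (c : CellG D n.+1) : to_hom (tgt c) = tgt (to_hom c).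
Proof.
rewrite -[RHS]/(pr2 (Cell_bdry (to_hom c))) to_hom_bdry.
by rewrite -[tgt c]/(pr2 (Cell_bdry c)) loop_bdry.
Qed.

Lemma to_hom_in n (c : CellG D n) : in_hom (X := X) (to_hom c).
Proof.
elim: n c => [|n IH] c.
  split.
    rewrite -[LHS]/(pr1 (Cell_bdry (to_hom c))) to_hom_bdry.
    exact: cellM_var.
  rewrite -[LHS]/(pr2 (Cell_bdry (to_hom c))) to_hom_bdry.
  exact: cellM_var.
have [es _] := IH (src c); have [_ et] := IH (tgt c).
by split; [rewrite -es to_hom_src | rewrite -et to_hom_tgt].
Qed.

(** By induction the source and target of c come from cells of D, and these are
    parallel in D because transposition separates spheres; so the boundary of c
    comes from a sphere of D. *)
Lemma in_hom_to_hom n (c : CellG C n.+1) :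
  in_hom (X := X) c -> exists d, to_hom d = c.
Proof.
elim: n c => [|n IH] c hc.
  case: (hc) => h1 h2; apply: (@to_hom_onto 0 c tt); apply: ssph_eq.
    by apply: etrans h1 _; exact/esym/cellM_var.
  by apply: etrans h2 _; exact/esym/cellM_var.
have [a ha] := IH _ (in_hom_src hc); have [b hb] := IH _ (in_hom_tgt hc).
have ab : bdry a = bdry b.
  apply: (proj1 (proj1 (transpose_bij n))).
  apply: etrans (esym (to_hom_bdry a)) (etrans _ (to_hom_bdry b)).
  rewrite ha hb; exact: Cell_prE.
apply: (@to_hom_onto n.+1 c (SSph ab)).
by apply: ssph_eq; [exact/esym/ha | exact/esym/hb].
Qed.

Definition to_loop n (c : CellG D n) : loop X n := exist _ (to_hom c) (to_hom_in c).

Lemma to_loop_src n (c : CellG D n.+1) : to_loop (src c) = src (to_loop c).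
Proof. by apply: loop_cell_eq; exact: to_hom_src. Qed.

Lemma to_loop_tgt n (c : CellG D n.+1) : to_loop (tgt c) = tgt (to_loop c).
Proof. by apply: loop_cell_eq; exact: to_hom_tgt. Qed.

Definition comparison : gmap (CellG D) (loop X) :=
  @GMap (CellG D) (loop X) to_loop to_loop_src to_loop_tgt.

(** Transposed form of the compatibility of [comparison] with the algebra
    structures, stated for morphisms of computads, where an equation can be
    tested on generators.  On a generator of Free Cell D, that is a cell c of D,
    both sides are the image of c in C. *)
Lemma transpose_eps n :
  mulh (transpose n) (sigM (slvl n) (ctrunc (eps D) n)) =
  mulh (ctrunc (eps C) n.+1)
    (mulh (theta_hom X n) (sigM (slvl n) (freeM (lvl n) comparison))).
Proof.
elim: n => [|n IH]; apply: shom_eq => [|c].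
- by case: (hbase _); case: (hbase _).
- rewrite -[LHS]/(cellM (transpose 0) (@var 0 level0 pt2 c)) cellM_var.
  rewrite -[RHS]/(cellM (ctrunc (eps C) 1)
    (cellM (theta_hom X 0) (@var 0 level0 pt2 c))) cellM_var.
  rewrite -[hgen (theta_hom X 0) c]/(cellM (freeM (lvl 1) (kappa X))
    (hgen (idto (pt2_free (loop X))) c)) idto_pt2.
  rewrite [X in cellM _ X](@cellM_var 0 level0).
  rewrite -[RHS]/(cellM (ctrunc (eps C) 1)
    (@var 0 level0 (free (lvl 1) (CellG C)) (bcpt C c))).
  exact: esym (@cellM_var 0 level0 (free (lvl 1) (CellG C)) (trunc C 1)
    (ctrunc (eps C) 1) (bcpt C c)).
- have hb : hbase (theta_hom X n.+1) = theta_hom X n.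
    by rewrite /theta_hom; congr mulh; exact: hbase_ssigfree.
  rewrite -[LHS]/(mulh (transpose_base n)
    (sigM (slvl n) (mulh (idh (trunc D n)) (ctrunc (eps D) n)))).
  rewrite -[RHS]/(mulh (mulh (idto (esym (truncE C n.+1))) (ctrunc (eps C) n.+1))
    (mulh (hbase (theta_hom X n.+1)) (sigM (slvl n) (freeM (lvl n) comparison)))).
  by rewrite hb mul1h /transpose_base -[LHS]mulhA IH [LHS]mulhA.
- rewrite -[LHS]/(to_hom c).
  rewrite -[RHS]/(cellM (ctrunc (eps C) n.+2) (cellM (theta_hom X n.+1)
    (sigcell (slvl n) (eta (loop X) n (to_loop c))))).
  rewrite -thetaE -OmegaTE OmegaT_var.
  exact: esym (@cellM_var n.+1 (lvl n.+1) (free (lvl n.+2) (CellG C))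
    (trunc C n.+2) (ctrunc (eps C) n.+2) (to_hom c)).
Qed.

Lemma comparison_act :
  gcomp comparison (oact (KT D)) = gcomp (oact (homcat (KTss C))) (TM comparison).
Proof.
apply: gmap_eq => n c; apply: loop_cell_eq.
rewrite [RHS]hom_actE thetaE.
rewrite -[LHS]/(cellM (transpose n.+1) (sigcell (slvl n) (cellM (ctrunc (eps D) n.+1) c))).
rewrite -[oact _]/(CellGM (eps C)) -[CellGM (eps C) _ _]/(cellM (ctrunc (eps C) n.+2) _).
rewrite -[TM comparison n c]/(cellM (freeM (lvl n.+1) comparison) c).
rewrite -!sigcellM -!cellMM -[in RHS]smulhA.
exact: (congr1 (fun s => cellM s (sigcell (slvl n) c)) (transpose_eps n.+1)).
Qed.

Lemma comparison_bij n : bijective (comparison n).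
Proof.
have inj : injective (comparison n).
  by move=> c d cd; apply: to_hom_inj; exact: (congr1 sval cd).
have onto x : exists c, comparison n c = x.
  by have [c hc] := in_hom_to_hom (svalP x); exists c; exact: loop_cell_eq.
have [g gK] := choice onto; exists g => // c; exact: inj.
Qed.

End LoopComputad.

Lemma bijective_oiso (A B : omegacat) (f : omap A B) :
  (forall n, bijective (f n)) -> oiso A B.
Proof.
move=> bf.
have inv n : {g : B n -> A n | cancel (f n) g /\ cancel g (f n)}.
  by apply: cid; have [g fK gK] := bf n; exists g.
pose g n := sval (inv n).
have fK n : cancel (f n) (g n) := proj1 (svalP (inv n)).
have gK n : cancel (g n) (f n) := proj2 (svalP (inv n)).
have gs n x : g n (src x) = src (g n.+1 x).
  by apply: (can_inj (fK n)); rewrite gfun_src !gK.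
have gt n x : g n (tgt x) = tgt (g n.+1 x).
  by apply: (can_inj (fK n)); rewrite gfun_tgt !gK.
pose g' : gmap B A := @GMap B A g gs gt.
have fg : gcomp f g' = gid B by apply: gmap_eq => n x; exact: gK.
have gE : gcomp g' (oact B) = gcomp (oact A) (TM g').
  apply: gmap_eq => n x; apply: (can_inj (fK n)).
  rewrite -[LHS]/(f n (g n (oact B n x))) gK.
  have := gmap_congr (TM g' n x) (ofunE f) => /= ->.
  rewrite -cellMM.
  have := freeMM (lvl n.+1) f g'; rewrite fg freeM1 /mulh /= => <-.
  by rewrite cellM1.
exists f, (OMap gE); split=> //.
by apply: gmap_eq => n x; exact: fK.
Qed.

Theorem proposition10 (C : bcomputad) :
  exists D : computad, oiso (KT D) (homcat (KTss C)).
Proof.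
exists (loop_computad C).
exact: (@bijective_oiso (KT (loop_computad C)) (homcat (KTss C))
  (@OMap (KT _) (homcat _) (comparison C) (comparison_act C)) (@comparison_bij C)).
Qed.
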